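(* Let $1\le k\le n$ be integers, $K=k(n-k+1)$ and $\lambda=(k-1)^{n-k}$ (the partition with $n-k$ parts equal to $k-1$). The Rise Delta formula follows from the Rational Shuffle formula together with the skewing formula; that is, if $$E_{K,k}\cdot 1=\sum_{\pi\in \mathrm{WPF}_{K,k}}t^{\mathrm{area}(\pi)}q^{\mathrm{dinv}(\pi)}x^{\pi}\qquad\text{and}\qquad s_\lambda^\perp(E_{K,k}\cdot1)=\Delta'_{e_{k-1}}e_n,$$ then $$\Delta'_{e_{k-1}}e_n=\sum_{P\in \mathrm{WLD}_{n,k}^{\mathrm{stack}}} t^{\mathrm{area}(P)} q^{\mathrm{hdinv}(P)} x^P .$$
   Context: Put $r=n-k+1$, so $K=kr$. $\Lambda(q,t)$ is the ring of symmetric functions in $X=(x_1,x_2,\dots)$ over $\mathbb{Q}(q,t)$, $f[\cdot]$ is plethystic substitution, and $s_\lambda^\perp$ is the adjoint of multiplication by the Schur function $s_\lambda$ for the Hall inner product. $\Delta'_{e_{k-1}}$ is the operator on $\Lambda(q,t)$ diagonal in the modified Macdonald basis: $\Delta'_{e_{k-1}}\widetilde H_\mu=e_{k-1}[B'_\mu]\widetilde H_\mu$, $B'_\mu=\sum_{\square\in\mu,\ \square\ne(0,0)}q^{a'(\square)}t^{\ell'(\square)}$, with $a',\ell'$ the numbers of boxes to the left of and below $\square$. $E_{K,k}$ is the elliptic Hall algebra operator obtained by rotating multiplication by $e_k$ to direction $(K,k)$. Explicitly, with $M=(1-q)(1-t)$, let $D_jF$ be the coefficient of $z^j$ in $F[X+M/z]\sum_{i\ge0}(-z)^ie_i$;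 let $R_0$ be multiplication by $-e_1$, $R_u=\frac1M[R_{u-1},D_r]$ for $u\ge 1$, $\Theta_c=\frac1M[R_{c-1},D_{r-1}]$ for $c\ge1$ (these are known to commute); let $\Phi$ be the algebra homomorphism from $\Lambda(q,t)$ to operators on $\Lambda(q,t)$ sending the algebraically independent generators $\frac{qt}{qt-1}h_c[X(\frac1{qt}-1)]$ to $\Theta_c$; then $E_{K,k}=(-1)^{k(r+1)}\Phi(e_k)$. Boxes of a grid are named by the coordinates $(x,y)$ of their lower left corner. Rational parking functions. A $(K,k)$ Dyck path is a lattice path of unit north and east steps from $(0,0)$ to $(k,K)$ staying weakly above the line $y=rx$. Its labeled boxes are the $K$ boxes immediately right of its vertical steps. An element $\pi\in\mathrm{WPF}_{K,k}$ is a $(K,k)$ Dyck path $D$ with a labeling of these boxes by positive integers, strictly increasing going up each column; $x^\pi=\prod x_{\text{label}}$. $\mathrm{area}(\pi)$ is the number of boxes between $D$ and the line $y=rx$ whose interior is not crossed by that line. An ordered pair of boxes $(a,b)$ is attacking if, with $\delta(x,y)=y-rx$, either $\delta(a)=\delta(b)$ and $a$ is to the left of $b$, or $\delta(a)=\delta(b)-1$ and $a$ is strictly to the right of $b$. $\mathrm{tdinv}(\pi)$ is the number of attacking pairs $(a,b)$ of labeled boxes with label of $a$ $<$ label of $b$; $\mathrm{maxtdinv}(D)$ is the maximum of $\mathrm{tdinv}$ over all labelings of $D$. $\mathrm{pathdinv}(D)$ is the number of boxes $c$ above $D$ with $\frac{\mathrm{arm}(c)}{\mathrm{leg}(c)+1}\le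 \frac kK<\frac{\mathrm{arm}(c)+1}{\mathrm{leg}(c)}$ (right inequality automatic if $\mathrm{leg}(c)=0$), where $\mathrm{arm}(c)$, $\mathrm{leg}(c)$ count the boxes strictly right of, respectively strictly below, $c$ that still lie above $D$. $\mathrm{dinv}(\pi)=\mathrm{pathdinv}(D)+\mathrm{tdinv}(\pi)-\mathrm{maxtdinv}(D)$. Stacked parking functions. A stack $S$ in the grid with $n$ rows and $k$ columns is a set of boxes with exactly one box in each row, at least one in each column, each box weakly right of the one in the row below. An element $P\in\mathrm{WLD}^{\mathrm{stack}}_{n,k}$ is a stack $S$ together with a north-east lattice path from $(0,0)$ to $(k,n)$ such that every box of $S$ lies below the path, and a labeling by positive integers of the $n$ boxes immediately right of its vertical steps, strictly increasing up each column; $x^P=\prod x_{\text{label}}$. $\mathrm{area}(P)$ is the number of boxes under the path and strictly above the topmost box of $S$ in their column. Let $w_i$ be the number of boxes of $S$ in column $i$; let $P'$ be the labeled path in the $n\times n$ grid obtained by inserting $w_i-1$ empty columns after column $i$ for each $i$ (a label in column $i$ moves to column $w_1+\dots+w_{i-1}+1$ of the same row). $\mathrm{hdinv}(P)$ is the number of pairs $(a,b)$ of labeled boxes of $P'$ with label of $a$ $<$ label of $b$ such that either $a,b$ lie on the same slope-one diagonal with $b$ to the right of $a$, or $a$ lies one diagonal lower than $b$ and to the right of $b$. *)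

(* Defs.v *)
From HB Require Import structures.
From mathcomp Require Import all_boot all_order all_algebra.
From mathcomp Require Import finmap monalg mpoly.

Set Implicit Arguments.
Unset Strict Implicit.
Unset Printing Implicit Defensive.

Import Order.TTheory GRing.Theory Num.Theory.

Local Open Scope ring_scope.

(* monalg rebinds this notation to another type of polynomials *)
Notation "{ 'mpoly' T [ n ] }" := (mpoly.mpoly n T) : type_scope.

Definition Qqt : fieldType := {fraction {mpoly rat[2]}}.
Definition q : Qqt := tofrac 'X_ord0.
Definition t : Qqt := tofrac 'X_ord_max.

(* Lambda(q,t) is presented as the polynomial ring Q(q,t)[p_1, p_2, ...] in the
   power sums: the variable of index i : nat of a monomial m : {cmonom nat}
   stands for p_(i+1), so m i is the number of parts i+1.  The map [expand]
   below recovers the series in x_1, x_2, ... *)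
Notation Sym := {malg Qqt[{cmonom nat}]}.

(* p_i, for i >= 1 *)
Definition psf (i : nat) : Sym := << ucm i.-1 >>.

Definition pcoeff (f : Sym) (m : {cmonom nat}) : Qqt := monalg.mcoeff m f.

(* The ring map acting as phi on scalars and sending p_i to a i, i >= 1. *)
Definition psubst (S : comNzRingType) (phi : Qqt -> S) (a : nat -> S) :
    Sym -> S :=
  monalg.mmap phi (fun m : {cmonom nat} => \prod_(i <- finsupp m) a i.+1 ^+ m i).

(* f(x_1, ..., x_N) = f(x_1, ..., x_N, 0, 0, ...) *)
Definition expand (N : nat) : Sym -> {mpoly Qqt[N]} :=
  psubst (@mpolyC N Qqt) (fun j => \sum_(i < N) 'X_i ^+ j).

(* A formal power series in x_1, x_2, ... is the compatible family of its
   truncations to x_1, ..., x_N (all N). *)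
Definition is_series (f : Sym) (S : forall N : nat, {mpoly Qqt[N]}) : Prop :=
  forall N, expand N f = S N.

(* f[X u], where u j is the value of p_j on the alphabet u *)
Definition pleth_scale (u : nat -> Qqt) : Sym -> Sym :=
  psubst (fun c => monalg.malgC c) (fun j => u j *: psf j).

(* h_n = sum over partitions of n of p_mu / z_mu, and
   e_n = sum of (-1)^(n - l(mu)) p_mu / z_mu; mu is given by its
   multiplicities, mu i being the number of parts i+1. *)
Definition is_mult (n : nat) (mu : {ffun 'I_n -> 'I_n.+1}) : bool :=
  (\sum_(i < n) i.+1 * mu i == n)%N.

Definition mult_term (n : nat) (mu : {ffun 'I_n -> 'I_n.+1}) : Sym :=
  \prod_(i < n)
    ((i.+1 ^ mu i * (mu i)`!)%N%:R^-1 *: psf i.+1 ^+ mu i).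

Definition hsf (n : nat) : Sym :=
  \sum_(mu : {ffun 'I_n -> 'I_n.+1} | is_mult mu) mult_term mu.

Definition esf (n : nat) : Sym :=
  \sum_(mu : {ffun 'I_n -> 'I_n.+1} | is_mult mu)
    (-1) ^+ (\sum_(i < n) i * mu i)%N *: mult_term mu.

Definition hall_z (m : {cmonom nat}) : nat :=
  (\prod_(i <- finsupp m) (i.+1 ^ m i * (m i)`!))%N.

(* <p_la, p_mu> = z_la if la = mu, and 0 otherwise *)
Definition hall (f g : Sym) : Qqt :=
  \sum_(m <- monalg.msupp f) pcoeff f m * pcoeff g m * (hall_z m)%:R.

Definition hall_adjoint (A B : Sym -> Sym) : Prop :=
  forall f g, hall (A f) g = hall f (B g).

(* Partitions: weakly decreasing sequences of positive integers. *)
Definition is_part (la : seq nat) : bool := sorted geq la && (0 \notin la)%N.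

Definition conj_part (la : seq nat) : seq nat :=
  mkseq (fun j => count (fun a => j < a)%N la) (head 0%N la).

Definition dominates (la mu : seq nat) : Prop :=
  sumn la = sumn mu /\
  forall i, (sumn (take i mu) <= sumn (take i la))%N.

(* s_la = det (h_(la_i - i + j)), with h_m = 0 for m < 0; trailing zeros in la
   are harmless. *)
Definition schur (la : seq nat) : Sym :=
  \det (\matrix_(i < size la, j < size la)
    (if (i <= nth 0 la i + j)%N then hsf (nth 0 la i + j - i)%N else 0)).

Definition in_schur_span (P : seq nat -> Prop) (f : Sym) : Prop :=
  exists s : seq (Qqt * seq nat),
    (forall x, x \in s -> is_part x.2 /\ P x.2) /\
    f = \sum_(x <- s) x.1 *: schur x.2.

(* The triangularity and normalization axioms that determine the modified
   Macdonald polynomials uniquely. *)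
Definition is_modified_macdonald (H : seq nat -> Sym) : Prop :=
  forall mu, is_part mu ->
    [/\ in_schur_span (fun la => dominates la mu)
          (pleth_scale (fun j => 1 - q ^+ j) (H mu)),
        in_schur_span (fun la => dominates la (conj_part mu))
          (pleth_scale (fun j => 1 - t ^+ j) (H mu))
      & hall (H mu) (hsf (sumn mu)) = 1].

(* p_j[B'_mu]; the box in column x of row y has a' = x and l' = y *)
Definition psum_B' (mu : seq nat) (j : nat) : Qqt :=
  \sum_(y < size mu) \sum_(x < nth 0%N mu y | ((x : nat), (y : nat)) != (0, 0)%N)
    (q ^+ x * t ^+ y) ^+ j.

Definition is_Delta'_e (H : seq nat -> Sym) (k : nat)
    (Delta : {linear Sym -> Sym}) : Prop :=
  forall mu, is_part mu ->
    Delta (H mu) = psubst idfun (psum_B' mu) (esf k) *: H mu.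

Definition Mqt : Qqt := (1 - q) * (1 - t).

(* F[X + M w] as a polynomial in w = 1/z *)
Definition pleth_shift : Sym -> {poly Sym} :=
  psubst (fun c => (monalg.malgC c)%:P)
    (fun j => (psf j)%:P + (((1 - q ^+ j) * (1 - t ^+ j))%:A : Sym) *: 'X^j).

Definition Dop (j : nat) (F : Sym) : Sym :=
  \sum_(i < size (pleth_shift F))
    (pleth_shift F)`_i * ((-1) ^+ (i + j) * esf (i + j)).

Definition opcomm (A B : Sym -> Sym) (F : Sym) : Sym := A (B F) - B (A F).

Fixpoint Rop (r u : nat) : Sym -> Sym :=
  if u is u'.+1 then fun F => Mqt^-1 *: opcomm (Rop r u') (Dop r) F
  else fun F => - esf 1 * F.

(* for r, c >= 1 *)
Definition Theta (r c : nat) (F : Sym) : Sym :=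
  Mqt^-1 *: opcomm (Rop r c.-1) (Dop r.-1) F.

(* (q t / (q t - 1)) h_c[X (1/(q t) - 1)] *)
Definition ehall_gen (c : nat) : Sym :=
  (q * t / (q * t - 1)) *:
    pleth_scale (fun j => (q * t) ^- j - 1) (hsf c).

Record is_Phi (r : nat) (Phi : Sym -> {linear Sym -> Sym}) : Prop := IsPhi {
  Phi1 : forall F, Phi 1 F = F;
  PhiM : forall f g F, Phi (f * g) F = Phi f (Phi g F);
  PhiD : forall f g F, Phi (f + g) F = Phi f F + Phi g F;
  PhiZ : forall a f F, Phi (a *: f) F = a *: Phi f F;
  Phi_gen : forall c F, (0 < c)%N -> Phi (ehall_gen c) F = Theta r c F }.

(* E_{kr,k} *)
Definition Eop (k r : nat) (Phi : Sym -> {linear Sym -> Sym}) (F : Sym) : Sym :=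
  (-1) ^+ (k * (r + 1)) *: Phi (esf k) F.

Local Open Scope nat_scope.

(* Boxes are pairs (x, y), named by their lower left corner. *)
Definition delta (r : nat) (b : nat * nat) : int :=
  (b.2%:Z - (r * b.1)%:Z)%R.

Definition attacking (r : nat) (a b : nat * nat) : bool :=
  ((delta r a == delta r b) && (a.1 < b.1)) ||
  ((delta r a == (delta r b - 1)%R) && (b.1 < a.1)).

(* c i is the column of the labeled box in row i, lab i its label *)
Definition tdinv (m r : nat) (c lab : 'I_m -> nat) : nat :=
  #|[set ij : 'I_m * 'I_m |
      attacking r (c ij.1, val ij.1) (c ij.2, val ij.2) &&
      (lab ij.1 < lab ij.2)]|.

Definition vals (m N : nat) (f : {ffun 'I_m -> 'I_N}) : 'I_m -> nat :=
  fun i => val (f i).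

Definition column_strict (m : nat) (c lab : 'I_m -> nat) : bool :=
  [forall i : 'I_m, forall j : 'I_m,
     (i < j) && (c i == c j) ==> (lab i < lab j)].

(* A north-east path from (0,0) to (k,m) is recorded by the abscissas of its
   m north steps: the i-th one goes from (c i, i) to (c i, i+1). *)
Definition is_path (m k : nat) (c : {ffun 'I_m -> 'I_k.+1}) : bool :=
  [forall i : 'I_m, forall j : 'I_m, (i <= j) ==> (c i <= c j)].

Section RationalParkingFunctions.

Variables k r : nat.
Local Notation K := (k * r).

Implicit Type D : {ffun 'I_K -> 'I_k.+1}.

(* The lowest point of a path on each vertical line other than x = k is the
   start of a north step or the end of an east step at the same height. *)
Definition is_dyck D : bool :=
  is_path D && [forall i : 'I_K, r * D i <= i].

(* Label l : 'I_N stands for the positive integer l+1. *)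
Definition is_wpf (N : nat) (D : {ffun 'I_K -> 'I_k.+1})
    (lab : {ffun 'I_K -> 'I_N}) : bool :=
  is_dyck D && column_strict (vals D) (vals lab).

(* (x, y) lies above the line and is not crossed by it iff its lower right
   corner (x+1, y) is weakly above the line. *)
Definition wpf_area D : nat :=
  #|[set b : 'I_k * 'I_K | (D b.2 <= b.1) && (r * b.1.+1 <= b.2)]|.

Definition above D : {set 'I_k * 'I_K} := 
  [set b : 'I_k * 'I_K | b.1 < D b.2].

Definition arm D (b : 'I_k * 'I_K) : nat :=
  #|[set b' : 'I_k * 'I_K in above D | (b'.2 == b.2) && (b.1 < b'.1)]|.

Definition leg D (b : 'I_k * 'I_K) : nat :=
  #|[set b' : 'I_k * 'I_K in above D | (b'.1 == b.1) && (b'.2 < b.2)]|.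

(* arm / (leg + 1) <= k / K < (arm + 1) / leg, with denominators cleared *)
Definition pathdinv D : nat :=
  #|[set b : 'I_k * 'I_K in above D | (arm D b * K <= k * (leg D b).+1) &&
                        (k * leg D b < (arm D b).+1 * K)]|.

(* Labels can be taken among K values: see tdinv_le_max. *)
Definition maxtdinv D : nat :=
  \max_(lab : {ffun 'I_K -> 'I_K} | column_strict (vals D) (vals lab))
    tdinv r (vals D) (vals lab).

Lemma tdinv_le_max D (lab : 'I_K -> nat) :
  column_strict (vals D) lab -> tdinv r (vals D) lab <= maxtdinv D.
Proof.
move=> /forallP lab_strict.
have rank_lt i : #|[set j | lab j < lab i]| < K.
  rewrite -[X in _ < X]card_ord -cardsT; apply: proper_card.
  by rewrite properE subsetT; apply/subsetPn; exists i; rewrite ?inE ?ltnn.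
pose rank := [ffun i => Ordinal (rank_lt i)].
have rank_mono i j : lab i < lab j -> rank i < rank j.
  move=> ltij; rewrite !ffunE /=; apply: proper_card; rewrite properE.
  apply/andP; split.
    by apply/subsetP=> l; rewrite !inE => /ltn_trans; apply.
  by apply/subsetPn; exists i; rewrite !inE ?ltnn.
have rank_strict : column_strict (vals D) (vals rank).
  apply/forallP=> i; apply/forallP=> j; apply/implyP=> Hij.
  by apply: rank_mono; apply: (implyP (forallP (lab_strict i) j)).
apply: leq_trans (leq_bigmax_cond _ rank_strict).
apply/subset_leq_card/subsetP=> -[i j]; rewrite !inE => /andP[-> /=].
exact: rank_mono.
Qed.

Definition dinv (N : nat) D (lab : {ffun 'I_K -> 'I_N}) : int :=
  ((pathdinv D)%:Z + (tdinv r (vals D) (vals lab))%:Z - (maxtdinv D)%:Z)%R.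

Definition wpf_series (N : nat) : {mpoly Qqt[N]} :=
  (\sum_(pi : {ffun 'I_K -> 'I_k.+1} * {ffun 'I_K -> 'I_N} | is_wpf pi.1 pi.2)
     (t ^+ wpf_area pi.1 * q ^ dinv pi.1 pi.2) *: \prod_(i < K) 'X_(pi.2 i))%R.

End RationalParkingFunctions.

Section StackedParkingFunctions.

Variables n k : nat.

Implicit Types (S : {ffun 'I_n -> 'I_k}) (c : {ffun 'I_n -> 'I_k.+1}).

(* S y is the column of the unique box of the stack in row y. *)
Definition is_stack S : bool :=
  [forall i : 'I_n, forall j : 'I_n, (i <= j) ==> (S i <= S j)] &&
  [forall x, exists y, S y == x].

Definition is_wld (N : nat) S c (lab : {ffun 'I_n -> 'I_N}) : bool :=
  [&& is_stack S, is_path c, [forall i : 'I_n, c i <= S i] & column_strict (vals c) (vals lab)].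

Definition wld_area S c : nat :=
  #|[set b : 'I_k * 'I_n |
      (c b.2 <= b.1) && [forall y, (S y == b.1) ==> (y < b.2)]]|.

Definition stack_width S (x : 'I_k) : nat := #|[set y | S y == x]|.

(* column of the labeled box of row i in the path P', columns from 0 *)
Definition spread S c (i : 'I_n) : nat :=
  \sum_(x < k | x < c i) stack_width S x.

Definition hdinv (N : nat) S c (lab : {ffun 'I_n -> 'I_N}) : nat :=
  tdinv 1 (spread S c) (vals lab).

Definition wld_series (N : nat) : {mpoly Qqt[N]} :=
  (\sum_(P : {ffun 'I_n -> 'I_k} * {ffun 'I_n -> 'I_k.+1} * {ffun 'I_n -> 'I_N}
         | is_wld P.1.1 P.1.2 P.2)
     (t ^+ wld_area P.1.1 P.1.2 * q ^+ hdinv P.1.1 P.1.2 P.2)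
       *: \prod_(i < n) 'X_(P.2 i))%R.

End StackedParkingFunctions.

(* Main.v *)
(* Write l = n - k.  The coefficient of x^a in s_la^perp f is <f, s_la h_a>.
   Expand s_la, la = (k-1)^l, by Jacobi-Trudi: in a rational parking function
   a letter occurs at most once per column, so h_j contributes 0 for j > k and
   the determinant is of Hessenberg type, a signed sum over the compositions
   of l.  Each of its terms counts rational parking functions with l extra
   letters, taken larger than all the others and hence sitting on top of the
   columns.  Recording which columns each extra letter omits, the remaining
   labels form a stacked parking function: column x has 1 + d_x boxes of the
   stack if d_x of the extra letters omit it.  The areas agree, and the dinv is
   that of the stacked parking function plus a quantity which is explicit in
   the omitted sets; the signed sum of the corresponding powers of q over all
   omitted sets with given column sums d is 1, because at each step it factors
   as one minus a product of which one factor vanishes. *)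

Require Import Defs.
From mathcomp Require Import all_boot all_order all_algebra.
From mathcomp Require Import finmap monalg mpoly.
From mathcomp Require Import zify ring lra.

Set Implicit Arguments.
Unset Strict Implicit.
Unset Printing Implicit Defensive.

Import Order.TTheory GRing.Theory Num.Theory.

Local Open Scope ring_scope.

(** * Coefficients of a symmetric function as pairings with products of h_n *)

(** Two obstacles shape the argument. Removing letters from a labeled path shifts the rows of
    everything above them. A path is therefore replaced by its set of pairs (column, label), which
    determines it: rows follow the lexicographic order. Conditions and statistics then depend only
    on the numbers of boxes left of a column and on ranks inside columns, and adding letters is a
    union of sets. The comparison of dinv need not hold for a single pair of columns. The path,
    maximal and mixed parts are sums over pairs of columns of sizes of intersections of two
    intervals of diagonals, hence combinations of minima. The defect of a pair is a discrete
    derivative, and it telescopes to 0 over all pairs. The keys of the signed sum come from the same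
    picture. The key of a column is the diagonal on which its next extra letter would sit, minus the
    number of letters already treated. Placing a letter preserves it, omitting one lowers it by
    1. *)

Local Notation cmul := (@monalg.mmul (cmonom nat)).
Local Notation cone := (@monalg.mone (cmonom nat)).

Lemma cm_split (m : {cmonom nat}) j : (0 < m j)%N ->
  m = cmul (ucm j) (divcm m (ucm j)).
Proof.
move=> mj; apply/eqP/cmP=> i; rewrite monalg.cmM divcmE ucmE.
by case: eqVneq => [<-|_]; rewrite ?subn0 // subnKC.
Qed.

Definition cweight (m : {cmonom nat}) : nat := (\sum_(i <- finsupp m) i.+1 * m i)%N.

Lemma big_finsupp (R : Type) (idx : R) (op : Monoid.com_law idx) (F : nat -> nat -> R)
    (m : {cmonom nat}) (d : {fset nat}) :
  (forall i, F i 0%N = idx) -> (finsupp m `<=` d)%fset ->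
  \big[op/idx]_(i <- finsupp m) F i (m i) = \big[op/idx]_(i <- d) F i (m i).
Proof.
move=> F0 le; rewrite [LHS](big_fset_incl _ le) // => i _.
by rewrite memNfinsupp => /eqP ->.
Qed.

(** Isolates the exponent of one variable: the rest [x] is common to all monomials that agree with
    [m] off [j], so a monomial can be compared with its multiple by p_(j+1). *)
Lemma big_finsuppM (R : Type) (idx : R) (op : Monoid.com_law idx) (F : nat -> nat -> R)
    (m : {cmonom nat}) j :
  (forall i, F i 0%N = idx) ->
  exists x, forall n (m' : {cmonom nat}), m' j = n ->
    (forall i, i != j -> m' i = m i) ->
    \big[op/idx]_(i <- finsupp m') F i (m' i) = op (F j n) x.
Proof.
move=> F0; pose d := (j |` finsupp m)%fset.
exists (\big[op/idx]_(i <- (finsupp m `\ j)%fset) F i (m i)).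
move=> n m' m'j m'E.
have le : (finsupp m' `<=` d)%fset.
  apply/fsubsetP=> i; rewrite !inE; case: (eqVneq i j) => //= ij.
  by rewrite !mem_finsupp m'E.
rewrite (big_finsupp op F0 le).
rewrite [LHS](big_fsetD1 j) ?fset1U1 //= m'j; congr (op _ _).
have -> : (d `\ j = finsupp m `\ j)%fset.
  by apply/fsetP=> i; rewrite !inE; case: eqVneq.
by apply: eq_big_seq => i; rewrite !inE => /andP[ij _] ; rewrite m'E.
Qed.

Lemma cweight1 : cweight cone = 0%N.
Proof. by rewrite /cweight monalg.mdom1 big_seq_fset0. Qed.

Lemma hall_z1 : hall_z cone = 1%N.
Proof. by rewrite /hall_z monalg.mdom1 big_seq_fset0. Qed.

Lemma cweightU j m : cweight (cmul (ucm j) m) = (j.+1 + cweight m)%N.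
Proof.
have [x Hx] := @big_finsuppM _ _ addn (fun i a => i.+1 * a)%N m j (fun i => muln0 _).
rewrite /cweight (Hx (m j).+1) ?(Hx (m j)) //=; last 2 first.
- by rewrite monalg.cmM ucmE eqxx.
- by move=> i ij; rewrite monalg.cmM ucmE eq_sym (negbTE ij).
by rewrite mulnS addnA.
Qed.

Lemma hall_zU j m : hall_z (cmul (ucm j) m) = (j.+1 * (m j).+1 * hall_z m)%N.
Proof.
have F0 i : (i.+1 ^ 0 * 0`! = 1)%N by rewrite expn0 fact0.
have [x Hx] := @big_finsuppM _ _ muln (fun i a => i.+1 ^ a * a`!)%N m j F0.
rewrite /hall_z (Hx (m j).+1) ?(Hx (m j)) //=; last 2 first.
- by rewrite monalg.cmM ucmE eqxx.
- by move=> i ij; rewrite monalg.cmM ucmE eq_sym (negbTE ij).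
by rewrite expnS factS mulnACA -!mulnA.
Qed.

Lemma Qqt_char0 : [pchar Qqt] =i pred0.
Proof.
move=> p; rewrite !inE; apply/negP => /andP[p_pr].
rewrite -[p%:R]/((p%:R : Qqt)) => /eqP.
have -> : (p%:R : Qqt) = tofrac (p%:R : mpoly.mpoly 2 rat) by rewrite rmorph_nat.
move/eqP; rewrite tofrac_eq0 -(rmorph_nat (@mpolyC 2 rat)) mpolyC_eq0.
by rewrite pnatr_eq0; case: p p_pr.
Qed.

Lemma natQqt_neq0 n : (0 < n)%N -> (n%:R : Qqt) != 0.
Proof. by move/pcharf0P: Qqt_char0 => ->; rewrite lt0n. Qed.

Lemma big_finsupp_ord (R : Type) (idx : R) (op : Monoid.com_law idx)
    (F : nat -> nat -> R) (m : {cmonom nat}) n :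
  (forall i, F i 0%N = idx) -> (forall i, (n <= i)%N -> m i = 0%N) ->
  \big[op/idx]_(i <- finsupp m) F i (m i) = \big[op/idx]_(i < n) F i (m i).
Proof.
move=> F0 m0; rewrite -(big_mkord predT (fun i => F i (m i))).
rewrite [RHS](bigID (fun i => m i != 0%N)) /= [X in op _ X]big1 ?Monoid.mulm1; last first.
  by move=> i; rewrite negbK => /eqP ->.
rewrite -[RHS]big_filter; apply: perm_big; apply: uniq_perm => //.
- exact: fset_uniq.
- by rewrite filter_uniq // iota_uniq.
move=> i; rewrite mem_finsupp mem_filter mem_index_iota /=.
case: eqP => //= mi; apply/esym; rewrite ltnNge.
by apply/negP=> /m0.
Qed.

Section MonomialAlgebra.

(* S stands for the ring Sym, U c m for its element c p_m, co m for the
   coefficient of p_m, and D j for p_(j+1)^perp = (j+1) d/dp_(j+1). *)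
Variables (F : fieldType) (S : comAlgType F).
Variables (U : F -> {cmonom nat} -> S) (co : {cmonom nat} -> S -> F).
Hypothesis S_ind : forall P : S -> Prop, P 0 ->
  (forall f g, P f -> P g -> P (f + g)) -> (forall c m, P (U c m)) ->
  forall f, P f.
Hypothesis UD : forall c1 c2 m, U (c1 + c2) m = U c1 m + U c2 m.
Hypothesis UM : forall c1 c2 m1 m2, U c1 m1 * U c2 m2 = U (c1 * c2) (cmul m1 m2).
Hypothesis U1 : U 1 cone = 1.
Hypothesis UZ : forall a c m, a *: U c m = U (a * c) m.
Hypothesis coD : forall m f g, co m (f + g) = co m f + co m g.
Hypothesis coU : forall m c m', co m (U c m') = c *+ (m' == m).

Lemma U_zero m : U 0 m = 0.
Proof. by apply: (addrI (U 0 m)); rewrite -UD !addr0. Qed.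

Lemma co_zero m : co m 0 = 0.
Proof. by apply: (addrI (co m 0)); rewrite -coD !addr0. Qed.

Variable D : nat -> S -> S.
Hypothesis DD : forall j f g, D j (f + g) = D j f + D j g.
Hypothesis DU : forall j c m,
  D j (U c m) = U (c * (j.+1 * m j)%N%:R) (divcm m (ucm j)).

Lemma D_zero j : D j 0 = 0.
Proof. by apply: (addrI (D j 0)); rewrite -DD !addr0. Qed.

Lemma D_mul j f g : D j (f * g) = D j f * g + f * D j g.
Proof.
elim/S_ind: f => [|f1 f2 IH1 IH2|c1 m1].
- by rewrite !(mul0r, D_zero) add0r.
- by rewrite mulrDl !DD IH1 IH2 !mulrDl addrACA.
elim/S_ind: g => [|g1 g2 IH1 IH2|c2 m2].
- by rewrite !(mulr0, D_zero) add0r.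
- by rewrite mulrDr !DD IH1 IH2 !mulrDr addrACA.
rewrite UM !DU !UM monalg.cmM mulnDr natrD.
have divM (m m' : {cmonom nat}) : (0 < m j)%N ->
    cmul (divcm m (ucm j)) m' = divcm (cmul m m') (ucm j).
  move=> mj; apply/eqP/cmP=> i; rewrite !(monalg.cmM, divcmE) ucmE.
  by case: eqVneq => [<-|_]; rewrite ?subn0 // addnBAC.
rewrite mulrDr UD; congr (_ + _).
  (* [divcm] truncates, so the quotient is wrong when the exponent is 0, but then its coefficient
     vanishes. *)
  case: (posnP (m1 j)) => [->|m1j]; last first.
    by rewrite divM // mulrAC.
  by rewrite muln0 !(mulr0, mul0r) !U_zero.
case: (posnP (m2 j)) => [->|m2j]; last first.
  rewrite [cmul m1 (divcm _ _)]monalg.mulmC divM // [cmul m2 _]monalg.mulmC.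
  by rewrite mulrA.
by rewrite muln0 !mulr0 !U_zero.
Qed.

(** The factor is the ratio of [hall_z] at p_(j+1) p_m and at p_m ([hall_zU]), so this is the
    adjointness of [D j] to multiplication by p_(j+1), read on coefficients. *)
Lemma co_D j f m :
  co m (D j f) = (j.+1 * (m j).+1)%N%:R * co (cmul (ucm j) m) f.
Proof.
elim/S_ind: f => [|f1 f2 IH1 IH2|c1 m1].
- by rewrite D_zero !co_zero mulr0.
- by rewrite DD !coD IH1 IH2 mulrDr.
rewrite DU !coU; case: (posnP (m1 j)) => [m1j|m1j].
  rewrite m1j muln0 mulr0 mul0rn; case: eqP => [m1E|]; last by rewrite mulr0.
  by move: m1j; rewrite m1E monalg.cmM ucmE eqxx.
case: (eqVneq m1 (cmul (ucm j) m)) => [->|ne].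
  rewrite monalg.cmM ucmE eqxx (_ : divcm _ _ = m) ?eqxx ?mulr1n ?add1n.
    by rewrite mulrC.
  by apply/eqP/cmP=> i; rewrite divcmE monalg.cmM addKn.
rewrite mulr0n mulr0; case: eqP => // mE; case/eqP: ne.
by rewrite -mE; apply: cm_split.
Qed.

Lemma co_coneM f g : co cone (f * g) = co cone f * co cone g.
Proof.
elim/S_ind: f => [|f1 f2 IH1 IH2|c1 m1].
- by rewrite mul0r co_zero mul0r.
- by rewrite mulrDl !coD IH1 IH2 mulrDl.
elim/S_ind: g => [|g1 g2 IH1 IH2|c2 m2].
- by rewrite mulr0 co_zero mulr0.
- by rewrite mulrDr !coD IH1 IH2 mulrDr.
rewrite UM !coU monalg.cmM_eq1.
by do 2!case: (_ == _); rewrite ?(mulr0n, mulr1n, mulr0, mul0r).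
Qed.

Lemma U_exp m a : U 1 m ^+ a = U 1 (iter a (cmul m) cone).
Proof. by elim: a => [|a IH]; rewrite ?expr0 ?U1 // exprS IH UM mulr1. Qed.

Lemma U_prod (I : finType) (c : I -> F) (m : I -> {cmonom nat}) :
  \prod_i U (c i) (m i) = U (\prod_i c i) (\big[cmul/cone]_i m i).
Proof.
elim: (index_enum I) => [|i r IH]; first by rewrite !big_nil U1.
by rewrite !big_cons IH UM.
Qed.

Lemma iter_ucm a i j : (iter a (cmul (ucm i)) cone) j = (a * (i == j))%N.
Proof.
elim: a => [|a IH] /=; first by rewrite monalg.cm1.
by rewrite monalg.cmM ucmE IH mulSn.
Qed.

Lemma big_cmul (I : finType) (m : I -> {cmonom nat}) j :
  (\big[cmul/cone]_i m i) j = (\sum_i m i j)%N.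
Proof.
elim: (index_enum I) => [|i r IH]; first by rewrite !big_nil monalg.cm1.
by rewrite !big_cons monalg.cmM IH.
Qed.

Lemma co_complete n m : co m (\sum_(mu : {ffun 'I_n -> 'I_n.+1} | is_mult mu)
    \prod_(i < n) ((i.+1 ^ mu i * (mu i)`!)%N%:R^-1 *: U 1 (@ucm nat i) ^+ mu i)) =
  if cweight m == n then (hall_z m)%:R^-1 else 0.
Proof.
rewrite (big_morph (co m) (coD m) (co_zero m)).
pose M (mu : {ffun 'I_n -> 'I_n.+1}) :=
  \big[cmul/cone]_(i < n) iter (mu i) (cmul (@ucm nat i)) cone.
have ME mu j : M mu j = (\sum_(i < n) mu i * (i == j :> nat))%N.
  by rewrite big_cmul; apply: eq_bigr => i _; rewrite iter_ucm.
have MEo mu (j : 'I_n) : M mu j = mu j.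
  rewrite ME (bigD1 j) //= eqxx muln1 big1 ?addn0 // => i ij.
  by rewrite (_ : (_ == _ :> nat) = false) ?muln0 //; apply/negbTE.
have ME0 mu j : (n <= j)%N -> M mu j = 0%N.
  move=> nj; rewrite ME big1 // => i _; case: eqP => [E|]; last by rewrite muln0.
  by have := ltn_ord i; rewrite E ltnNge nj.
have term (mu : {ffun 'I_n -> 'I_n.+1}) : co m (\prod_(i < n) ((i.+1 ^ mu i * (mu i)`!)%N%:R^-1 *:
    U 1 (@ucm nat i) ^+ mu i)) = if M mu == m then (hall_z m)%:R^-1 else 0.
  under eq_bigr do rewrite U_exp UZ mulr1.
  rewrite U_prod coU -/(M mu); case: eqP => [<-|]; last by rewrite mulr0n.
  have F0 i : (i.+1 ^ 0 * 0`! = 1)%N by rewrite expn0 fact0.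
  rewrite /hall_z (@big_finsupp_ord _ _ muln (fun i a => i.+1 ^ a * a`!)%N _ n) //;
    last exact: ME0.
  rewrite mulr1n prodfV natr_prod; congr (_^-1); apply: eq_bigr => i _.
  by rewrite MEo.
under eq_bigr do rewrite term.
have wM mu : cweight (M mu) = (\sum_(i < n) i.+1 * mu i)%N.
  rewrite /cweight (@big_finsupp_ord _ _ addn (fun i a => i.+1 * a)%N _ n) //;
    [|by move=> i; rewrite muln0|exact: ME0].
  by apply: eq_bigr => i _; rewrite MEo.
case: eqP => [wm|wm]; last first.
  rewrite big1 // => mu; rewrite /is_mult => /eqP mun; case: eqP => // E.
  by case: wm; rewrite -E wM.
(* A monomial of weight [n] has no variable of index [n] or more and no exponent above [n], so it
   comes from exactly one [mu]. *)
have mbound i : (i.+1 * m i <= n)%N.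
  rewrite -wm /cweight; case: (posnP (m i)) => [->|mi]; first by rewrite muln0.
  by rewrite (big_fsetD1 i) ?mem_finsupp -?lt0n //= leq_addr.
have m0 i : (n <= i)%N -> m i = 0%N.
  by move=> ni; have := mbound i; case: (m i) => // a; rewrite mulnS; lia.
pose mu0 := [ffun i : 'I_n => inord (m i) : 'I_n.+1].
have mu0E i : mu0 i = m i :> nat.
  by rewrite ffunE inordK // ltnS; apply: leq_trans (mbound i); rewrite leq_pmull.
have Mmu0 : M mu0 = m.
  apply/eqP/cmP=> j; case: (ltnP j n) => [jn|nj]; last by rewrite ME0 ?m0.
  by rewrite (MEo mu0 (Ordinal jn)) mu0E.
rewrite (bigD1 mu0) /=; last by rewrite /is_mult -wM Mmu0 wm.
rewrite Mmu0 eqxx big1 ?addr0 // => mu /andP[_ ne]; case: eqP => // E.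
case/eqP: ne; apply/ffunP=> i; apply/val_inj.
by rewrite /= mu0E -E (MEo mu i).
Qed.

Variables (h : nat -> S) (hl : S -> S -> F).
Hypothesis co_h : forall n m,
  co m (h n) = if cweight m == n then (hall_z m)%:R^-1 else 0.
Hypothesis co_inj : forall f g, (forall m, co m f = co m g) -> f = g.
Hypothesis natF_neq0 : forall n, (0 < n)%N -> n%:R != 0 :> F.

(** The coefficient of p_m in h_n is 1/z_m, and the factor in [co_D] cancels the ratio of the two
    z. *)
Lemma D_h j n : D j (h n) = if (j < n)%N then h (n - j.+1) else 0.
Proof.
apply: co_inj => m; rewrite co_D co_h cweightU hall_zU.
case: ltnP => [jn|nj]; last first.
  by rewrite co_zero; case: eqP; rewrite ?mulr0 // => H; exfalso; lia.
rewrite co_h; case: eqVneq => [E|ne]; last first.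
  by rewrite mulr0; case: eqVneq => // E; exfalso; lia.
rewrite (_ : (cweight m == _) = true); last by apply/eqP; lia.
rewrite [in X in _ * X]natrM invfM mulVKf //.
by apply: natF_neq0; rewrite muln_gt0.
Qed.

Lemma D_one j : D j 1 = 0.
Proof.
apply: (addrI (D j 1)); rewrite addr0 -[in RHS](mulr1 1) D_mul.
by rewrite !(mulr1, mul1r).
Qed.

Lemma D_prod j (I : finType) (f : I -> S) :
  D j (\prod_i f i) = \sum_i \prod_i' (if i' == i then D j (f i') else f i').
Proof.
have gen (r : seq I) : uniq r -> D j (\prod_(i <- r) f i) =
    \sum_(i <- r) \prod_(i' <- r) (if i' == i then D j (f i') else f i').
  elim: r => [|i r IH] /=; first by rewrite !big_nil D_one.
  case/andP=> ir /IH{}IH; rewrite !big_cons D_mul IH eqxx; congr (_ + _).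
    by congr (_ * _); apply: eq_big_seq => i' i'r; case: eqP ir => // <-; rewrite i'r.
  rewrite big_distrr /=; apply: eq_big_seq => i' i'r; rewrite big_cons.
  by case: eqP ir => // ->; rewrite i'r.
exact: (gen _ (index_enum_uniq I)).
Qed.

Hypothesis hlD : forall f1 f2 g, hl (f1 + f2) g = hl f1 g + hl f2 g.
Hypothesis hlU : forall c m g, hl (U c m) g = c * co m g * (hall_z m)%:R.

Variables (N : nat) (ex : S -> mpoly.mpoly N F).
Hypothesis exD : forall f g, ex (f + g) = ex f + ex g.
Hypothesis exU : forall c m, ex (U c m) = c *: ex (U 1 m).
Hypothesis ex1 : ex (U 1 cone) = 1.
Hypothesis exUj : forall j m,
  ex (U 1 (cmul (ucm j) m)) = (\sum_(i < N) 'X_i ^+ j.+1) * ex (U 1 m).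

Definition hprod (a : 'I_N -> nat) : S := \prod_i h (a i).

Lemma coD_hprod j m (a : 'I_N -> nat) :
  co m (D j (hprod a)) = \sum_(i | (j < a i)%N)
    co m (hprod (fun i' => if i' == i then (a i' - j.+1)%N else a i')).
Proof.
have coS (I : finType) (P : pred I) (f : I -> S) :
    co m (\sum_(i | P i) f i) = \sum_(i | P i) co m (f i).
  by apply: (big_morph _ (coD m) (co_zero m)).
rewrite D_prod coS [RHS]big_mkcond; apply: eq_bigr => i _.
case: ifP => ji.
  congr co; apply: eq_bigr => i' _; case: eqP => // ->.
  by rewrite D_h ji.
by rewrite (bigD1 i) //= eqxx D_h ji mul0r co_zero.
Qed.

Lemma mcoeffMX_lt (p : mpoly.mpoly N F) (m a : 'X_{1..N}) :
  mpoly.mcoeff a (p * 'X_[m]) =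
  if (m <= a)%MM then mpoly.mcoeff (a - m)%MM p else 0.
Proof.
case: ifPn => [le|nle].
  by rewrite -{1}(submK le) addmC mcoeffMX.
rewrite (mpoly.mpolyE p) mulr_suml raddf_sum /= big1 // => m' _.
rewrite -scalerAl -mpolyXD mpoly.mcoeffZ mcoeffX; case: eqP => [E|]; last by rewrite mulr0.
by case/negP: nle; rewrite -E lem_addl.
Qed.

(* Multiplying f by p_(j+1) has the same effect on both sides, since
   D j h_n = h_(n-j-1) and D j is a derivation. *)
Lemma mcoeff_hall (f : S) (a : 'X_{1..N}) :
  mpoly.mcoeff a (ex f) = hl f (hprod a).
Proof.
have ex0 : ex 0 = 0 by apply: (addrI (ex 0)); rewrite -exD !addr0.
have hl0 g : hl 0 g = 0 by apply: (addrI (hl 0 g)); rewrite -hlD !addr0.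
elim/S_ind: f => [|f1 f2 IH1 IH2|c m].
- by rewrite ex0 hl0 mpoly.mcoeff0.
- by rewrite exD hlD mpoly.mcoeffD IH1 IH2.
rewrite exU hlU mpoly.mcoeffZ -mulrA; congr (_ * _).
have [w] := ubnP (monalg.mdeg m); elim: w m a => // w IH m a.
case: (eqVneq m cone) => [-> _|m1].
  rewrite ex1 hall_z1 mulr1 mpoly.mcoeff1.
  rewrite /hprod (big_morph (co cone) co_coneM (id1 := 1)); last first.
    by rewrite -U1 coU eqxx.
  case: eqVneq => [->|a0].
    by rewrite big1 // => i _; rewrite co_h cweight1 mnm0E hall_z1 invr1.
  have [i ai] : exists i, a i != 0%N.
    apply/existsP; rewrite -negb_forall; apply: contra a0 => /forallP a0.
    by apply/eqP/mnmP=> i; rewrite mnm0E; apply/eqP.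
  by rewrite (bigD1 i) //= co_h cweight1 eq_sym (negbTE ai) mul0r.
have [j mj] : exists j, (0 < m j)%N.
  case: (fset_0Vmem (finsupp m)) => [E|[j jm]]; last first.
    by exists j; rewrite lt0n -mem_finsupp.
  by case/eqP: m1; apply: monalg.mdeg_eq0I; rewrite monalg.mdegE E big_seq_fset0.
rewrite (cm_split mj); move: (divcm _ _) => m'.
rewrite monalg.mdegM monalg.mdegU add1n ltnS => /IH{}IH.
rewrite exUj mulr_suml raddf_sum /= hall_zU natrM mulrA.
rewrite [co _ _ * _]mulrC -co_D coD_hprod mulr_suml [RHS]big_mkcond /=.
apply: eq_bigr => i _; rewrite mulrC mpolyXn mcoeffMX_lt.
have -> : (U_(i) *+ j.+1 <= a)%MM = (j < a i)%N.
  apply/mnm_lepP/idP => [/(_ i)|lt i']; first by rewrite mulmnE mnm1E eqxx mul1n.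
  by rewrite mulmnE mnm1E; case: eqP => [<-|_]; rewrite ?mul1n ?mul0n.
case: ifP => // _; rewrite IH; congr (co _ _ * _).
apply: eq_bigr => i' _; rewrite mnmBE mulmnE mnm1E eq_sym.
by case: eqP; rewrite ?mul1n ?mul0n ?subn0.
Qed.

End MonomialAlgebra.

Definition symU (c : Qqt) (m : {cmonom nat}) : Sym := << c *g m >>.
Definition symco (m : {cmonom nat}) (f : Sym) : Qqt := pcoeff f m.

Lemma symU_ind (P : Sym -> Prop) :
  P 0 -> (forall f g, P f -> P g -> P (f + g)) ->
  (forall c m, P (symU c m)) -> forall f, P f.
Proof.
move=> P0 PD PU f; rewrite (monalg.monalgE f).
by apply: (big_ind P) => // m _; apply: PU.
Qed.

Lemma symUD c1 c2 m : symU (c1 + c2) m = symU c1 m + symU c2 m.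
Proof. exact: monalg.monalgUD. Qed.

Lemma symUM c1 c2 m1 m2 : symU c1 m1 * symU c2 m2 = symU (c1 * c2) (cmul m1 m2).
Proof. by rewrite /symU monalg.malgM_def monalg.fgmulUU. Qed.

Lemma symU1 : symU 1 cone = 1.
Proof. by []. Qed.

Lemma symcoD m f g : symco m (f + g) = symco m f + symco m g.
Proof. exact: monalg.mcoeffD. Qed.

Lemma symcoU m c m' : symco m (symU c m') = c *+ (m' == m).
Proof. exact: monalg.mcoeffU. Qed.

Lemma symco_inj f g : (forall m, symco m f = symco m g) -> f = g.
Proof. by move=> fg; apply/monalg.malgP. Qed.

Lemma symUZ (a c : Qqt) m : a *: symU c m = symU (a * c) m.
Proof.
apply: symco_inj => m'; rewrite symcoU.
apply: etrans (monalg.mcoeffZ _ _ _) _.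
by rewrite -mulrnAr; congr (a * _); apply: symcoU.
Qed.

Definition pperp (j : nat) : Sym -> Sym :=
  monalg.mmap (fun c : Qqt => monalg.malgC c : Sym)
    (fun m : {cmonom nat} => symU (j.+1 * m j)%N%:R (divcm m (ucm j))).

Lemma pperpD j f g : pperp j (f + g) = pperp j f + pperp j g.
Proof. exact: raddfD. Qed.

Lemma pperpU j c m :
  pperp j (symU c m) = symU (c * (j.+1 * m j)%N%:R) (divcm m (ucm j)).
Proof.
apply: etrans (monalg.mmapU _ _) _.
by apply: etrans (symUM c _ cone _) _; rewrite monalg.mul1m.
Qed.

Lemma symco_h n m :
  symco m (hsf n) = if cweight m == n then (hall_z m)%:R^-1 else 0.
Proof.
have E := co_complete symUM symU1 symUZ symcoD symcoU n m.
apply: etrans _ E; congr (symco m _).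
Qed.

Lemma hallD f1 f2 g : hall (f1 + f2) g = hall f1 g + hall f2 g.
Proof.
have E f : hall f g = monalg.mmap idfun (fun m => pcoeff g m * (hall_z m)%:R) f.
  by apply: eq_bigr => m _; rewrite mulrA.
rewrite !E; exact: raddfD.
Qed.

Lemma hallU c m g : hall (symU c m) g = c * symco m g * (hall_z m)%:R.
Proof.
have E f : hall f g = monalg.mmap idfun (fun m => pcoeff g m * (hall_z m)%:R) f.
  by apply: eq_bigr => m' _; rewrite mulrA.
by rewrite E /symU monalg.mmapU mulrA.
Qed.

Section Expand.
Variable N : nat.

Definition emon (m : {cmonom nat}) : mpoly.mpoly N Qqt :=
  \prod_(i <- finsupp m) (\sum_(l < N) 'X_l ^+ i.+1) ^+ m i.

Lemma emonU j m : emon (cmul (ucm j) m) = (\sum_(i < N) 'X_i ^+ j.+1) * emon m.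
Proof.
pose G (i a : nat) : mpoly.mpoly N Qqt := (\sum_(l < N) 'X_l ^+ i.+1) ^+ a.
have G0 i : G i 0%N = 1 by rewrite /G expr0.
have [x Hx] := @big_finsuppM _ _ *%R G m j G0.
rewrite /emon (Hx (m j).+1) ?(Hx (m j)) //=; last 2 first.
- by rewrite monalg.cmM ucmE eqxx.
- by move=> i ij; rewrite monalg.cmM ucmE eq_sym (negbTE ij).
by rewrite /G exprS mulrA.
Qed.

Lemma expandU c m : expand N (symU c m) = c *: emon m.
Proof. by rewrite /expand /psubst /symU monalg.mmapU mul_mpolyC. Qed.

Lemma expandU1 m : expand N (symU 1 m) = emon m.
Proof. exact: etrans (expandU 1 m) (scale1r _). Qed.

Lemma expandUZ c m : expand N (symU c m) = c *: expand N (symU 1 m).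
Proof.
apply: etrans (expandU c m) _.
exact: (congr1 (fun p => c *: p) (esym (expandU1 m))).
Qed.

Lemma expand1 : expand N (symU 1 cone) = 1.
Proof. by apply: etrans (expandU1 _) _; rewrite /emon monalg.mdom1 big_seq_fset0. Qed.

Lemma expandUj j m : expand N (symU 1 (cmul (ucm j) m)) =
  (\sum_(i < N) 'X_i ^+ j.+1) * expand N (symU 1 m).
Proof.
apply: etrans (expandU1 _) _; apply: etrans (emonU _ _) _.
exact: (congr1 (fun p => (\sum_(i < N) 'X_i ^+ j.+1) * p) (esym (expandU1 m))).
Qed.

Lemma expandD f g : expand N (f + g) = expand N f + expand N g.
Proof. exact: raddfD. Qed.

Lemma mcoeff_expand (f : Sym) (a : 'X_{1..N}) :
  mpoly.mcoeff a (expand N f) = hall f (\prod_(i < N) hsf (a i)).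
Proof.
exact: (mcoeff_hall symU_ind symUD symUM symU1 symcoD symcoU pperpD pperpU
  symco_h symco_inj natQqt_neq0 hallD hallU expandD expandUZ expand1 expandUj).
Qed.

End Expand.

(** * Jacobi-Trudi determinants and a signed sum over 0-1 matrices *)

Section Hessenberg.

Variables (R : comNzRingType) (c : nat) (f : nat -> R).

Definition jtentry (i j : nat) : R := if (i <= c + j)%N then f (c + j - i)%N else 0.

(* An arbitrary first column makes the expansion along the first row
   recursive. *)
Definition jtmx (l : nat) (g : nat -> R) : 'M[R]_l :=
  \matrix_(i < l, j < l) if (j == 0 :> nat) then g i else jtentry i j.

Definition jtdet (l : nat) : R := \det (\matrix_(i < l, j < l) jtentry i j).

Lemma jtdetE l : jtdet l = \det (jtmx l (fun i => jtentry i 0)).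
Proof.
by congr (\det _); apply/matrixP=> i j; rewrite !mxE; case: eqP => [->|].
Qed.

Hypothesis f_big : forall j, (c.+1 < j)%N -> f j = 0.

(** Past the first column, row 0 has the single nonzero entry f(c+1). The entries depend only on j -
    i, so the first minor is again a Jacobi-Trudi matrix, and the second keeps the free first
    column, shifted by one. *)
Lemma det_jtmxS l g : \det (jtmx l.+2 g) =
  g 0%N * jtdet l.+1 - f c.+1 * \det (jtmx l.+1 (fun i => g i.+1)).
Proof.
rewrite (expand_det_row _ ord0) big_ord_recl big_ord_recl big1 /=; last first.
  move=> j _; rewrite !mxE /jtentry /= ?leq0n ?subn0 f_big ?mul0r //.
  by rewrite /bump; lia.
rewrite addr0 !mxE /= /cofactor /= expr0 expr1 !mul1r; congr (_ + _).
  congr (_ * \det _); apply/matrixP=> i j; rewrite !mxE /= /jtentry /bump /=.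
  by rewrite addnS.
rewrite mulN1r mulrN /jtentry /= ?leq0n ?subn0 addn1; congr (- (_ * \det _)).
apply/matrixP=> i j; rewrite !mxE /= /bump /=.
by case: j => [[|j] lj] //=; rewrite /jtentry !(addnS, add1n, addn0).
Qed.

Lemma det_jtmx l g : \det (jtmx l.+1 g) =
  \sum_(m < l.+1) (- f c.+1) ^+ m * g m * jtdet (l - m).
Proof.
elim: l g => [|l IH] g.
  rewrite big_ord1 expr0 mul1r subn0 {1}/jtdet det_mx00 mulr1.
  by rewrite det_mx11 mxE.
rewrite det_jtmxS IH [RHS]big_ord_recl expr0 mul1r subn0; congr (_ + _).
rewrite big_distrr -sumrN; apply: eq_bigr => i _.
by rewrite /bump /= ?add1n subSS exprS; ring.
Qed.

(** The sum stops at [c] because h has no negative index: the first-column entry of row [m] is 0 for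
    [m] above [c]. *)
Lemma jtdetS l : jtdet l.+1 =
  \sum_(m < (minn l c).+1) (- f c.+1) ^+ m * f (c - m)%N * jtdet (l - m).
Proof.
rewrite jtdetE det_jtmx /jtentry.
rewrite -(big_mkord predT (fun m => (- f c.+1) ^+ m *
  (if (m <= c + 0)%N then f (c + 0 - m)%N else 0) * jtdet (l - m))).
rewrite -(big_mkord predT (fun m => (- f c.+1) ^+ m * f (c - m)%N * jtdet (l - m))).
rewrite (big_cat_nat (n := (minn l c).+1)) //=; last by rewrite ltnS geq_minl.
rewrite [X in _ + X]big_nat_cond [X in _ + X]big1 ?addr0.
  rewrite big_nat_cond [RHS]big_nat_cond; apply: eq_bigr => m /andP[H _].
  by rewrite addn0 ifT //; lia.
move=> m /andP[H _]; rewrite ifF ?mulr0 ?mul0r //.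
by apply/negbTE; lia.
Qed.

End Hessenberg.

(* The pair (s, [:: e_1; ...; e_l]) stands for (-1)^s f(e_1)...f(e_l); the parts
   m + 1 of a composition of l give the blocks f(c+1)^m f(c-m). *)
Fixpoint hexp (c fuel l : nat) : seq (nat * seq nat) :=
  if fuel is n.+1 then
    if l is l'.+1 then
      flatten [seq [seq ((m + x.1)%N, nseq m c.+1 ++ (c - m)%N :: x.2)
                   | x <- hexp c n (l' - m)]
              | m <- iota 0 (minn l' c).+1]
    else [:: (0%N, [::])]
  else [:: (0%N, [::])].

Lemma hexpS c n l : hexp c n.+1 l.+1 =
  flatten [seq [seq ((m + x.1)%N, nseq m c.+1 ++ (c - m)%N :: x.2)
               | x <- hexp c n (l - m)] | m <- iota 0 (minn l c).+1].
Proof. by []. Qed.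

Lemma big_hexpS (R : nmodType) c n l (G : nat * seq nat -> R) :
  \sum_(x <- hexp c n.+1 l.+1) G x =
  \sum_(m < (minn l c).+1) \sum_(x <- hexp c n (l - m))
     G ((m + x.1)%N, nseq m c.+1 ++ (c - m)%N :: x.2).
Proof.
rewrite hexpS big_flatten big_map -(big_mkord predT (fun m => \sum_(x <- hexp c n (l - m))
     G ((m + x.1)%N, nseq m c.+1 ++ (c - m)%N :: x.2))) /index_iota subn0.
by apply: eq_bigr => m _; rewrite big_map.
Qed.

Lemma size_hexp c n l x : (l <= n)%N -> x \in hexp c n l -> size x.2 = l.
Proof.
elim: n l x => [|n IH] [|l] x; try by move=> // _; rewrite inE => /eqP ->.
rewrite ltnS hexpS => ln /flattenP[s /mapP[m]]; rewrite mem_iota => mlt ->.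
case/mapP=> y /IH yP -> /=.
by rewrite size_cat size_nseq /= yP; lia.
Qed.

Lemma jtdet_hexp (R : comNzRingType) c (f : nat -> R) n l :
  (forall j, (c.+1 < j)%N -> f j = 0) -> (l <= n)%N ->
  jtdet c f l = \sum_(x <- hexp c n l) (-1) ^+ x.1 * \prod_(e <- x.2) f e.
Proof.
move=> f_big; elim: n l => [|n IH] [|l] // ln;
  try by rewrite /jtdet det_mx00 big_seq1 big_nil expr0 mulr1.
rewrite big_hexpS jtdetS //; apply: eq_bigr => m _.
rewrite IH; last by lia.
rewrite big_distrr; apply: eq_bigr => x _ /=.
rewrite big_cat big_cons /= big_nseq iter_mulr_1 (exprNn (f c.+1)) exprD.
move: ((-1) ^+ m) ((-1) ^+ x.1) (f c.+1 ^+ m) (\prod_(e <- _) _) => s1 s2 p1 p2.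
by ring.
Qed.

(** * Signed sums over sequences of omitted sets *)

Section SignedSum.

Variables (R : comNzRingType) (u : R) (k : nat).
Implicit Types (ka : {ffun 'I_k -> int}) (d : {ffun 'I_k -> nat}) (S : {set 'I_k}).

(* The columns are ordered by their keys, ties being broken by the index. *)
Definition key_below (a : int) (j : nat) (b : int) (i : nat) : bool :=
  (a < b) || ((a == b) && (j < i)%N).

Definition key_rank ka (x : 'I_k) : nat := #|[set y : 'I_k | key_below (ka x) x (ka y) y]|.

Definition lower_keys ka S : {ffun 'I_k -> int} := [ffun x => ka x - (x \in S)%:Z].
Definition lower_mult d S : {ffun 'I_k -> nat} := [ffun x => (d x - (x \in S))%N].

(* Sum over the sequences of sets S of omitted columns, with #|S| = k - e for
   the successive e in es, in which column x occurs d x times; each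
   occurrence lowers the key of the column by 1. *)
Fixpoint gsum (es : seq nat) ka d : R :=
  if es is e :: es' then
    \sum_(S : {set 'I_k} | (#|S| + e == k)%N && [forall x in S, (0 < d x)%N])
      u ^+ (\sum_(x in S) key_rank ka x) * gsum es' (lower_keys ka S) (lower_mult d S)
  else (d == [ffun=> 0%N])%:R.

Definition last_above ka d (a : int) (j : nat) : nat :=
  #|[set i : 'I_k | key_below a j (ka i - (d i)%:Z) i]|.

(* Exponent of u for the singletons taken in decreasing order of keys: when the
   e-th copy of column j is taken, the columns above it are those whose final
   key is. *)
Definition sorted_cost ka d : nat :=
  (\sum_(j < k) \sum_(e < d j) last_above ka d (ka j - e%:Z) j)%N.

Lemma lower_keys0 ka : lower_keys ka set0 = ka.
Proof. by apply/ffunP=> x; rewrite ffunE inE subr0. Qed.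

Lemma lower_mult0 d : lower_mult d set0 = d.
Proof. by apply/ffunP=> x; rewrite ffunE inE subn0. Qed.

(** A letter with index [k] occurs in every column, so its omitted set is empty and neither keys nor
    multiplicities change. *)
Lemma gsum_nseq m es ka d : gsum (nseq m k ++ es) ka d = gsum es ka d.
Proof.
elim: m => [|m IH] //=; rewrite (bigD1 set0) /=; last first.
  by rewrite cards0 add0n eqxx; apply/forall_inP=> x; rewrite inE.
rewrite lower_keys0 lower_mult0 IH big_set0 expr0 mul1r big1 ?addr0 //.
move=> S /andP[/andP[H _] /negP[]]; by rewrite -cards_eq0; move: H; rewrite -[X in _ == X]add0n eqn_add2r.
Qed.

(** Taking one copy of a column lowers its key and its multiplicity together, so the final key
    [ka i - d i] is invariant. *)
Lemma last_above_lower ka d S : (forall x, x \in S -> (0 < d x)%N) ->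
  last_above (lower_keys ka S) (lower_mult d S) =2 last_above ka d.
Proof.
move=> Sd a j; apply: eq_card => i; rewrite !inE !ffunE.
suff -> : ka i - (i \in S)%:Z - (d i - (i \in S))%N%:Z = ka i - (d i)%:Z by [].
by case: (boolP (i \in S)) => [/Sd|] /=; lia.
Qed.

(** Splits off the first copy of each column in [S]; the remaining copies start from the lowered
    key, and final keys do not move. *)
Lemma sorted_cost_lower ka d S : (forall x, x \in S -> (0 < d x)%N) ->
  sorted_cost ka d =
  (\sum_(j in S) last_above ka d (ka j) j + sorted_cost (lower_keys ka S) (lower_mult d S))%N.
Proof.
move=> Sd; rewrite /sorted_cost [X in (X + _)%N]big_mkcond -big_split /=.
apply: eq_bigr => j _; under [X in (_ + X)%N]eq_bigr do rewrite last_above_lower //.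
rewrite !ffunE; case: ifP => jS /=; last by rewrite subn0 subr0.
case: (d j) (Sd j jS) => // e _; rewrite big_ord_recl subr0 subn1 /=.
congr (_ + _)%N; apply: eq_bigr => i _; congr last_above.
by rewrite /bump /=; lia.
Qed.

Lemma last_above_le_rank ka d j : (last_above ka d (ka j) j <= key_rank ka j)%N.
Proof.
apply/subset_leq_card/subsetP=> i; rewrite !inE /key_below => /orP[H|/andP[/eqP H ?]]; lia.
Qed.

Lemma top_rank ka d : d != [ffun=> 0%N] ->
  exists2 a : 'I_k, (0 < d a)%N & key_rank ka a = last_above ka d (ka a) a.
Proof.
move=> d0; have [a0 da0] : exists a, (0 < d a)%N.
  apply/existsP; move: d0; apply: contraR; rewrite negb_exists => /forallP H.
  by apply/eqP/ffunP=> x; rewrite ffunE; apply/eqP; rewrite -leqn0 leqNgt.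
(* Indices are below [k], so [ka x * k + x] encodes the lexicographic order on (key, index). Columns
   above the maximizer have no copies left, hence already carry their final keys. *)
have [a /= da amax] := @Order.TotalTheory.arg_maxP _ _ _ a0 (fun x => (0 < d x)%N)
  (fun x : 'I_k => ka x * k%:Z + x%:Z) da0.
exists a => //; apply: eq_card => y; rewrite !inE.
case: (posnP (d y)) => [->|dy]; first by rewrite subr0.
have := amax y dy => H; have ly := ltn_ord y; have la := ltn_ord a.
have nb : key_below (ka a) a (ka y) y = false.
  apply/negbTE/negP; rewrite /key_below => /orP[lt|/andP[/eqP E lt]]; last by rewrite E in H; lia.
  by nia.
rewrite nb; apply/esym/negbTE/negP => H'; move/negP: nb; apply.
by move: H'; rewrite /key_below => /orP[?|/andP[/eqP ? ?]]; lia.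
Qed.

Lemma signed_subsets (w : 'I_k -> R) (A : {set 'I_k}) :
  \sum_(S : {set 'I_k} | (S \subset A) && (S != set0)) (-1) ^+ #|S|.-1 * \prod_(x in S) w x =
  1 - \prod_(x in A) (1 - w x).
Proof.
have -> : \prod_(x in A) (1 - w x) = \prod_x ((if x \in A then - w x else 0) + 1).
  by rewrite big_mkcond; apply: eq_bigr => x _; case: ifP; rewrite ?add0r // addrC.
rewrite bigA_distr [X in 1 - X](bigD1 set0) //=.
rewrite [X in 1 - (X + _)]big1 => [|x _]; last by rewrite inE.
rewrite opprD addrA subrr add0r -sumrN.
rewrite big_mkcond [RHS]big_mkcond; apply: eq_bigr => S _ /=.
case: (boolP (S == set0)) => [|S0]; first by rewrite andbF.
rewrite andbT; case: ifPn => [/subsetP SA|/subsetPn[x xS xA]]; last first.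
  by rewrite (bigD1 x) //= xS (negbTE xA) mul0r oppr0.
have -> : \prod_i (if i \in S then if i \in A then - w i else 0 else 1) = \prod_(i in S) - w i.
  by rewrite [RHS]big_mkcond; apply: eq_bigr => x _; case: ifP => // /SA ->.
rewrite prodrN -mulNr; congr (_ * _).
by move: S0; rewrite -card_gt0; case: #|S| => // n _; rewrite exprS mulN1r opprK.
Qed.

(* By induction the sum is u ^ sorted_cost times the alternating sum evaluated
   in signed_subsets, with w x = u ^ (key_rank ka x - last_above ka d (ka x) x);
   the exponent is 0 at the highest column x with d x > 0. *)
Lemma gsum_hexp n l ka d : (0 < k)%N -> (l <= n)%N ->
  \sum_(x <- hexp k.-1 n l) (-1) ^+ x.1 * gsum x.2 ka d =
  if (\sum_x d x == l)%N then u ^+ sorted_cost ka d else 0.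
Proof.
move=> k_gt0; have base ka' d' : (-1) ^+ 0 * (d' == [ffun=> 0%N])%:R =
    if (\sum_x d' x == 0)%N then u ^+ sorted_cost ka' d' else 0.
  rewrite expr0 mul1r (_ : (d' == _) = (\sum_x d' x == 0)%N); last first.
    rewrite sum_nat_eq0; apply/eqP/forallP => [-> x|H]; first by rewrite ffunE.
    by apply/ffunP=> x; rewrite ffunE; apply/eqP; apply: (implyP (H x)).
  case: eqP => // /eqP; rewrite sum_nat_eq0 => /forallP H.
  rewrite /sorted_cost big1 // => x _; rewrite big1 // => [[e /=]].
  by rewrite (eqP (implyP (H x) isT)).
elim: n l ka d => [|n IH] [|l] ka d // ln; try by rewrite big_seq1; apply: base.
rewrite big_hexpS prednK //.
pose P S := [forall x in S, (0 < d x)%N].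
(* In a block of [hexp] the [m] letters h_k omit nothing and h_(k-1-m) omits [m + 1] columns, so [m]
   is recovered from the first nonempty omitted set as [#|S|.-1]. *)
transitivity (\sum_(S : {set 'I_k} | P S && (0 < #|S| <= l.+1)%N)
   (-1) ^+ #|S|.-1 * u ^+ (\sum_(x in S) key_rank ka x) *
   if (\sum_x lower_mult d S x == l.+1 - #|S|)%N
   then u ^+ sorted_cost (lower_keys ka S) (lower_mult d S) else 0).
  have E (m : 'I_(minn l k.-1).+1) :
      \sum_(x <- hexp k.-1 n (l - m))
       (-1) ^+ (m + x.1) * gsum (nseq m k ++ (k.-1 - m)%N :: x.2) ka d =
      \sum_(S : {set 'I_k} | P S && (#|S| == m.+1))
        (-1) ^+ #|S|.-1 * u ^+ (\sum_(x in S) key_rank ka x) *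
       if (\sum_x lower_mult d S x == l.+1 - #|S|)%N
         then u ^+ sorted_cost (lower_keys ka S) (lower_mult d S) else 0.
    under eq_bigr do rewrite gsum_nseq /= big_distrr.
    rewrite exchange_big /=; apply: eq_big => [S|S /andP[/eqP HS _]].
      by rewrite andbC; congr (_ && _); have := ltn_ord m; lia.
    have Sm : #|S| = m.+1.
      by have := ltn_ord m; rewrite ltnS leq_min => /andP[_ mk]; move: HS; set s := #|S|; lia.
    rewrite Sm subSS -IH; last by lia.
    by rewrite big_distrr; apply: eq_bigr => x _ /=; rewrite exprD; ring.
  under eq_bigr do rewrite E.
  rewrite (exchange_big_dep (fun S => P S && (0 < #|S| <= l.+1)%N)) /=; last first.
    by move=> m S _ /andP[-> /eqP ->]; have := ltn_ord m; lia.
  apply: eq_bigr => S /andP[PS Sl].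
  have Sk : (#|S| <= k)%N by rewrite -[X in (_ <= X)%N]card_ord max_card.
  have lt : (#|S|.-1 < (minn l k.-1).+1)%N.
    by move: Sl Sk; set s := #|S|; rewrite ltnS leq_min; lia.
  rewrite (big_pred1 (Ordinal lt)) // => m /=; rewrite PS -val_eqE /=.
  by apply/eqP/eqP; lia.
have sumdl S : P S -> (\sum_x lower_mult d S x + #|S| = \sum_x d x)%N.
  move/forall_inP=> Sd; rewrite -sum1_card [X in (_ + X)%N]big_mkcond -big_split /=.
  by apply: eq_bigr => x _; rewrite ffunE; case: (boolP (x \in S)) => [/Sd|] /=; lia.
case: eqP => [sd|sd]; last first.
  rewrite big1 // => S /andP[PS Sl]; case: eqP; rewrite ?mulr0 // => E.
  by case: sd; have := sumdl S PS; lia.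
pose A := [set x | (0 < d x)%N].
pose w x := u ^+ (key_rank ka x - last_above ka d (ka x) x).
transitivity (\sum_(S : {set 'I_k} | (S \subset A) && (S != set0))
  u ^+ sorted_cost ka d * ((-1) ^+ #|S|.-1 * \prod_(x in S) w x)).
  apply: eq_big => [S|S /andP[PS Sl]].
    have -> : (S \subset A) = P S.
      by apply/subsetP/forall_inP => H x /H; rewrite inE.
    rewrite -card_gt0; case: (boolP (P S)) => //= /sumdl; rewrite sd.
    by case: (0 < #|S|)%N => //=; lia.
  have Sd : forall x, x \in S -> (0 < d x)%N by apply/forall_inP.
  rewrite ifT; last by apply/eqP; have := sumdl S PS; lia.
  rewrite (sorted_cost_lower ka Sd) exprD -!prodrXr.
  have -> : \prod_(x in S) u ^+ key_rank ka x =
      \prod_(x in S) u ^+ last_above ka d (ka x) x * \prod_(x in S) w x.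
    rewrite -big_split; apply: eq_bigr => x _ /=.
    by rewrite /w -exprD subnKC // last_above_le_rank.
  by move: (\prod_(x in S) w x) (\prod_(x in S) _) => p1 p2; ring.
rewrite -big_distrr /= signed_subsets.
have d0 : d != [ffun=> 0%N].
  by apply: contra_eqN sd => /eqP ->; rewrite big1 // => x; rewrite ffunE.
have [a da ra] := top_rank ka d0.
by rewrite (bigD1 a) ?inE //= /w ra subnn expr0 subrr mul0r subr0 mulr1.
Qed.

End SignedSum.

Lemma big_ffun_ordS (V : nmodType) (T : finType) l (P : pred {ffun 'I_l.+1 -> T})
    (G : {ffun 'I_l.+1 -> T} -> V) :
  \sum_(M | P M) G M =
  \sum_(S : T) \sum_(M : {ffun 'I_l -> T} | P [ffun i => oapp M S (unlift ord0 i)])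
     G [ffun i => oapp M S (unlift ord0 i)].
Proof.
rewrite pair_big_dep /=.
rewrite (reindex (fun p : T * {ffun 'I_l -> T} =>
   [ffun i => oapp p.2 p.1 (unlift ord0 i)])) //=.
exists (fun M => (M ord0, [ffun j => M (lift ord0 j)])).
  move=> [S M] _ /=; rewrite ffunE unlift_none /=; congr (_, _).
  by apply/ffunP=> j; rewrite !ffunE liftK.
move=> M _; apply/ffunP=> i; rewrite ffunE /=.
by case: unliftP => [j ->|->] //=; rewrite ffunE.
Qed.

Section Matrices.

Variables (R : comNzRingType) (u : R) (k : nat).

(** The keys with which the recursion of [gsum] reaches its [m]-th set. *)
Definition stage l (ka : {ffun 'I_k -> int}) (M : {ffun 'I_l -> {set 'I_k}}) (m : nat) :
    {ffun 'I_k -> int} :=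
  [ffun x => ka x - (\sum_(m' < l | (m' < m)%N) (x \in M m'))%N%:Z].

Definition matrix_cost l (ka : {ffun 'I_k -> int}) (M : {ffun 'I_l -> {set 'I_k}}) : nat :=
  (\sum_(m < l) \sum_(x in M m) key_rank (stage ka M m) x)%N.

Definition column_sum l (M : {ffun 'I_l -> {set 'I_k}}) : {ffun 'I_k -> nat} :=
  [ffun x => (\sum_(m < l) (x \in M m))%N].

(** Unrolls the recursion: parking functions present all omitted sets at once, while the signed sum
    is evaluated one set at a time. *)
Lemma gsum_matrix l es ka d : size es = l ->
  gsum u es ka d =
  \sum_(M : {ffun 'I_l -> {set 'I_k}} |
     [forall m : 'I_l, (#|M m| + nth 0%N es m == k)%N] && (column_sum M == d))
    u ^+ matrix_cost ka M.
Proof.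
elim: es l ka d => [|e es IH] [|l] //= ka d.
  move=> _; pose M0 := [ffun i : 'I_0 => set0 : {set 'I_k}].
  have M_eq M : M = M0 by apply/ffunP=> [[]].
  rewrite big_mkcond (big_pred1 M0) /=; last by move=> M; apply/esym/eqP.
  rewrite /matrix_cost big_ord0 expr0 (_ : [forall _, _] = true) /=; last first.
    by apply/forallP=> -[].
  have -> : column_sum M0 = [ffun=> 0%N].
    by apply/ffunP=> x; rewrite !ffunE big_ord0.
  by rewrite eq_sym; case: (_ == d).
case=> es_l; rewrite big_ffun_ordS big_mkcond /=; apply: eq_bigr => S _.
pose cons M : {ffun 'I_l.+1 -> {set 'I_k}} := [ffun i => oapp M S (unlift ord0 i)].
have cons0 (M : {ffun 'I_l -> {set 'I_k}}) : cons M ord0 = S by rewrite ffunE unlift_none.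
have consS (M : {ffun 'I_l -> {set 'I_k}}) i : cons M (lift ord0 i) = M i by rewrite ffunE liftK.
have sizes (M : {ffun 'I_l -> {set 'I_k}}) : [forall m, (#|cons M m| + nth 0%N (e :: es) m == k)%N] =
    (#|S| + e == k)%N && [forall m, (#|M m| + nth 0%N es m == k)%N].
  apply/forallP/andP => [H|[H1 /forallP H2] m].
    split; first by have := H ord0; rewrite cons0.
    by apply/forallP=> m; have := H (lift ord0 m); rewrite consS.
  by case: (unliftP ord0 m) => [j ->|->]; rewrite ?consS ?cons0 //; apply: H2.
have csum (M : {ffun 'I_l -> {set 'I_k}}) x : column_sum (cons M) x = ((x \in S) + column_sum M x)%N.
  rewrite !ffunE big_ord_recl cons0; congr (_ + _)%N.
  by apply: eq_bigr => m _; rewrite consS.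
(* Positivity of [d] on [S] makes the truncated subtraction in [lower_mult] exact. *)
have csum_eq (M : {ffun 'I_l -> {set 'I_k}}) : (column_sum (cons M) == d) =
    [forall x in S, (0 < d x)%N] && (column_sum M == lower_mult d S).
  apply/eqP/andP => [<-|[/forall_inP Sd /eqP H]].
    split; first by apply/forall_inP=> x xS; rewrite csum xS.
    by apply/eqP/ffunP=> x; rewrite [in RHS]ffunE csum addKn.
  apply/ffunP=> x; rewrite csum H ffunE.
  by case: (boolP (x \in S)) => [/Sd|_]; rewrite ?subn0 //= add1n subn1 => /prednK.
have costE (M : {ffun 'I_l -> {set 'I_k}}) : matrix_cost ka (cons M) =
    (\sum_(x in S) key_rank ka x + matrix_cost (lower_keys ka S) M)%N.
  rewrite /matrix_cost big_ord_recl cons0; congr (_ + _)%N.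
    apply: eq_bigr => x _; congr key_rank; apply/ffunP=> y.
    by rewrite ffunE big_pred0 ?subr0.
  apply: eq_bigr => m _; rewrite consS; apply: eq_bigr => x _; congr key_rank.
  apply/ffunP=> y; rewrite !ffunE big_mkcond big_ord_recl /= cons0 [in RHS]big_mkcond.
  rewrite PoszD opprD addrA; congr (_ - (Posz _)); apply: eq_bigr => i _.
  by rewrite /bump /= consS.
case: ifP => H; last first.
  by rewrite big_pred0 // => M; rewrite sizes csum_eq andbACA H.
rewrite (IH l) // big_distrr; apply: eq_big => [M|M _] /=.
  by rewrite sizes csum_eq andbACA H.
by rewrite costE exprD.
Qed.

End Matrices.

Local Close Scope ring_scope.

(** * Labeled paths as sets of pairs (column, label) *)

Lemma card_ord_lt m i : i <= m -> #|[set j : 'I_m | j < i]| = i.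
Proof.
move=> im; have inj : injective (widen_ord im) by move=> x y /(congr1 val) /= /val_inj.
rewrite -[RHS]card_ord -(card_imset _ inj); apply: eq_card => j; rewrite inE.
apply/idP/imsetP => [ji|[x _ ->]]; last exact: (ltn_ord x).
by exists (Ordinal ji) => //; apply: val_inj.
Qed.

Section Boxes.

Variables m k N : nat.
Implicit Types (c : {ffun 'I_m -> 'I_k.+1}) (lab : {ffun 'I_m -> 'I_N}).
Implicit Types (B : {set 'I_k * 'I_N}) (p : 'I_k * 'I_N).

Definition labeled_path c lab : bool :=
  [&& is_path c, [forall i, c i < k] & column_strict (vals c) (vals lab)].

Definition boxset c lab : {set 'I_k * 'I_N} :=
  [set p : 'I_k * 'I_N | [exists i, (c i == p.1 :> nat) && (lab i == p.2)]].

Definition lexlt p p' : bool := (p.1 < p'.1) || ((p.1 == p'.1) && (p.2 < p'.2)).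

Lemma lexlt_trans : transitive lexlt.
Proof.
move=> [y b] [x a] [z e]; rewrite /lexlt /= -!val_eqE /= => /orP[H|/andP[/eqP -> H]].
  by case/orP=> [H'|/andP[/eqP <- _]]; rewrite ?(ltn_trans H H') ?H.
case/orP=> [->//|/andP[-> /= H']].
by rewrite (ltn_trans H H') orbT.
Qed.

Lemma sorted_enum_lex B : sorted lexlt (enum B).
Proof.
have pw_enum n : pairwise (fun x y : 'I_n => x < y) (enum 'I_n).
  rewrite -(pairwise_map val ltn) val_enum_ord -sorted_pairwise ?iota_ltn_sorted //.
  exact: ltn_trans.
have pw (s1 : seq 'I_k) (s2 : seq 'I_N) : pairwise (fun x y : 'I_k => x < y) s1 ->
    pairwise (fun a b : 'I_N => a < b) s2 ->
    pairwise lexlt [seq (x, a) | x <- s1, a <- s2].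
  move=> + pw2; elim: s1 => [|x s1 IH] //= /andP[/allP xs1 /IH pw1].
  rewrite pairwise_cat pw1 andbT; apply/andP; split.
    apply/allrelP=> _ _ /mapP[a _ ->] /allpairsP[[y b] [/= ys _ ->]].
    by rewrite /lexlt /= xs1.
  rewrite pairwise_map; apply: sub_pairwise pw2 => a b /= ab.
  by rewrite /lexlt /= eqxx ab orbT.
rewrite (sorted_pairwise lexlt_trans) {1}/enum_mem.
apply: pairwise_filter; rewrite unlock /=; exact: pw.
Qed.

(** Counting predecessors gives the row back, because boxes read upwards along a path increase
    lexicographically ([box_lex]). *)
Definition lexrow B p : nat := #|[set p' in B | lexlt p' p]|.

Section OnePath.
Variables (c : {ffun 'I_m -> 'I_k.+1}) (lab : {ffun 'I_m -> 'I_N}).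
Hypothesis cl : labeled_path c lab.

Lemma col_lt i : c i < k.
Proof. by case/and3P: cl => _ /forallP. Qed.

Definition box (i : 'I_m) : 'I_k * 'I_N := (Ordinal (col_lt i), lab i).

Lemma box_lex (i j : 'I_m) : i < j -> lexlt (box i) (box j).
Proof.
move=> ij; case/and3P: cl => /forallP path _ /forallP strict; rewrite /lexlt /=.
have := implyP (forallP (path i) j) (ltnW ij); rewrite leq_eqVlt => /orP[E|->//].
have := implyP (forallP (strict i) j); rewrite ij /vals => /(_ E) ->.
by rewrite -val_eqE /= E orbT.
Qed.

Lemma lexlt_irr p : lexlt p p = false.
Proof. by rewrite /lexlt !ltnn andbF. Qed.

Lemma lexlt_asym p p' : lexlt p p' -> lexlt p' p = false.
Proof.
case: p p' => [x a] [y b]; rewrite /lexlt /= -!val_eqE /=.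
by case: (ltngtP (val x) (val y)) => //= _; case: ltngtP.
Qed.

Lemma lexlt_box (i j : 'I_m) : lexlt (box i) (box j) = (i < j).
Proof.
have [ij|ji|E] := ltngtP i j.
- exact: box_lex ij.
- exact: lexlt_asym (box_lex ji).
- by rewrite (val_inj E); apply: lexlt_irr.
Qed.

Lemma box_inj : injective box.
Proof.
move=> i j E; have [ij|ji|/val_inj //] := ltngtP i j.
- by have := box_lex ij; rewrite E lexlt_irr.
- by have := box_lex ji; rewrite E lexlt_irr.
Qed.

Lemma boxsetE : boxset c lab = [set box i | i : 'I_m].
Proof.
apply/setP=> p; rewrite inE; apply/existsP/imsetP => [[i /andP[/eqP ci /eqP li]]|[i _ ->]].
  by exists i => //; case: p ci li => x a /= ci <-; congr (_, _); apply/val_inj.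
by exists i; rewrite /= !eqxx.
Qed.

Lemma card_boxset : #|boxset c lab| = m.
Proof. by rewrite boxsetE card_imset ?cardsT ?card_ord //; apply: box_inj. Qed.

Lemma big_boxset (R : Type) (idx : R) (op : Monoid.com_law idx) (G : 'I_k * 'I_N -> R)  :
  \big[op/idx]_(p in boxset c lab) G p = \big[op/idx]_(i < m) G (box i).
Proof.
rewrite boxsetE big_imset /=; first by apply: eq_bigl => i; rewrite inE.
by move=> i j _ _; apply: box_inj.
Qed.

Lemma lexrow_box (i : 'I_m) : lexrow (boxset c lab) (box i) = i.
Proof.
rewrite -[RHS](@card_ord_lt m) ?(ltnW (ltn_ord i)) //.
rewrite -(card_imset _ box_inj) /lexrow; apply: eq_card => p; rewrite inE boxsetE.
apply/andP/imsetP => [[/imsetP[j _ ->]]|[j]]; last first.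
  by rewrite inE => ji ->; rewrite lexlt_box imset_f.
by rewrite lexlt_box => ji; exists j; rewrite ?inE.
Qed.

Lemma height_boxset j :
  #|[set p in boxset c lab | p.1 < j]| = #|[set i | c i < j]|.
Proof.
rewrite -[RHS](card_imset _ box_inj); apply: eq_card => p; rewrite inE boxsetE.
apply/andP/imsetP => [[/imsetP[i _ ->]] ci|[i]]; first by exists i; rewrite ?inE.
by rewrite inE => ci ->; rewrite imset_f.
Qed.

(** Columns weakly increase with the row, so the rows in columns before [j] form an initial segment.
    This turns conditions on rows into conditions on heights. *)
Lemma leq_height (i : 'I_m) j : (#|[set i' | c i' < j]| <= i) = (j <= c i).
Proof.
case/and3P: cl => /forallP path _ _.
have mono (a b : 'I_m) : a <= b -> c a <= c b by apply/implyP/(forallP (path a)).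
case: (leqP j (c i)) => [jc|cj]; last first.
  apply/negbTE; rewrite -ltnNge -[X in X <= _](@card_ord_lt m) //.
  apply/subset_leq_card/subsetP=> i'; rewrite !inE ltnS => ii.
  exact: leq_ltn_trans (mono _ _ ii) cj.
rewrite -[X in _ <= X](@card_ord_lt m) ?(ltnW (ltn_ord i)) //.
apply/subset_leq_card/subsetP=> i'; rewrite !inE => ci'; rewrite ltnNge.
by apply/negP=> /mono; rewrite leqNgt (leq_trans ci' jc).
Qed.

End OnePath.

(* The rows are recovered by listing the pairs lexicographically. *)
Lemma boxset_surj B : #|B| = m -> exists c lab, labeled_path c lab /\ boxset c lab = B.
Proof.
move=> Bm; pose e (i : 'I_m) := enum_val (cast_ord (esym Bm) i).
have lex_e (i j : 'I_m) : i < j -> lexlt (e i) (e j).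
  move=> ij; have srt := sorted_enum_lex B.
  have szi (l : 'I_m) : l < size (enum B) by rewrite -cardE Bm.
  rewrite /e (enum_val_nth (e i)) [enum_val (cast_ord _ j)](enum_val_nth (e i)) /=.
  by apply: (sorted_ltn_nth lexlt_trans) => //; rewrite inE.
pose c := [ffun i => inord (e i).1 : 'I_k.+1].
have cE i : c i = (e i).1 :> nat.
  by rewrite ffunE inordK // ltnW // ltnS ltn_ord.
pose lab := [ffun i => (e i).2].
exists c, lab; split.
  apply/and3P; split.
  - apply/forallP=> i; apply/forallP=> j; apply/implyP.
    rewrite !cE leq_eqVlt => /orP[/eqP/val_inj -> //|/lex_e].
    by rewrite /lexlt => /orP[/ltnW //|/andP[/eqP ->]].
  - by apply/forallP=> i; rewrite cE.
  - apply/forallP=> i; apply/forallP=> j; apply/implyP=> /andP[/lex_e H /eqP E].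
    have E1 : (e i).1 = (e j).1 :> nat by rewrite -!cE.
    by move: H; rewrite /lexlt E1 ltnn /vals !ffunE => /andP[].
apply/setP=> p; rewrite inE; apply/existsP/idP => [[i /andP[]]|pB].
  rewrite cE ffunE => /eqP E1 /eqP E2.
  have -> : p = e i by case: p E1 E2 => x a /= /val_inj <- <-; case: (e i).
  exact: enum_valP.
exists (cast_ord Bm (enum_rank_in pB p)).
by rewrite cE ffunE /e cast_ordK enum_rankK_in ?eqxx.
Qed.

Lemma boxset_inj c lab c' lab' : labeled_path c lab -> labeled_path c' lab' ->
  boxset c lab = boxset c' lab' -> c = c' /\ lab = lab'.
Proof.
move=> H H' E.
have boxE i : box H i = box H' i.
  have : box H i \in boxset c' lab' by rewrite -E boxsetE imset_f.
  rewrite boxsetE => /imsetP[j _ Eij]; rewrite Eij; congr box; apply/val_inj.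
  by rewrite /= -(lexrow_box H' j) -Eij -E lexrow_box.
split; apply/ffunP=> i; have [] := boxE i => // Ec _.
exact/val_inj.
Qed.

Lemma big_labeled_path (V : nmodType) (Q : pred {ffun 'I_m -> 'I_k.+1})
    (QB : pred {set 'I_k * 'I_N}) (G : {ffun 'I_m -> 'I_k.+1} -> {ffun 'I_m -> 'I_N} -> V)
    (GB : {set 'I_k * 'I_N} -> V) :
  (forall c lab, labeled_path c lab -> Q c = QB (boxset c lab)) ->
  (forall c lab, labeled_path c lab -> Q c -> G c lab = GB (boxset c lab)) ->
  (\sum_(p | labeled_path p.1 p.2 && Q p.1) G p.1 p.2 =
   \sum_(B : {set 'I_k * 'I_N} | (#|B| == m) && QB B) GB B)%R.
Proof.
move=> Q_eq G_eq.
pose A := [set p : {ffun 'I_m -> 'I_k.+1} * {ffun 'I_m -> 'I_N} | labeled_path p.1 p.2 && Q p.1].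
transitivity (\sum_(p in A) GB (boxset p.1 p.2))%R.
  by apply: eq_big => [p|p /andP[? ?]]; [rewrite inE | apply: G_eq].
rewrite -(@big_imset _ _ _ _ _ (fun p : {ffun 'I_m -> 'I_k.+1} * {ffun 'I_m -> 'I_N}
  => boxset p.1 p.2) (mem A) GB); last first.
  move=> [c lab] [c' lab']; rewrite !inE /= => /andP[H _] /andP[H' _] E.
  by have [-> ->] := boxset_inj H H' E.
apply: eq_bigl => B; apply/imsetP/andP => [[[c lab]]|[/eqP /boxset_surj[c [lab [H E]]] QBB]].
  by rewrite inE /= => /andP[H Qc] ->; rewrite card_boxset // eqxx -Q_eq.
by exists (c, lab); rewrite ?inE /= ?H ?(Q_eq c lab H) ?E.
Qed.

End Boxes.

(** * Statistics of parking functions read off from box sets *)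

Lemma card_ord_itv m a b : b <= m -> #|[set i : 'I_m | a <= i & i < b]| = b - a.
Proof.
move=> bm; case: (leqP a b) => [ab|ba]; last first.
  rewrite (_ : b - a = 0); last by lia.
  by apply: eq_card0 => i; rewrite !inE; apply/negP => /andP[]; lia.
have -> : [set i : 'I_m | a <= i & i < b] = [set i : 'I_m | i < b] :\: [set i : 'I_m | i < a].
  by apply/setP=> i; rewrite !inE -leqNgt.
rewrite cardsD (setIidPr _) ?card_ord_lt ?(leq_trans ab) //.
by apply/subsetP=> i; rewrite !inE => /leq_trans; apply.
Qed.

Lemma card_pairs (I J : finType) (P : I -> J -> bool) :
  #|[set p : I * J | P p.1 p.2]| = \sum_i \sum_j P i j.
Proof.
rewrite -sum1_card pair_big /= big_mkcond /=.
by apply: eq_bigr => p _; rewrite inE; case: (P _ _).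
Qed.

(** The attack relation on column and diagonal; natural numbers suffice for the diagonals because
    the path stays weakly above the line. *)
Definition att_pos (x s y s' : nat) : bool :=
  ((s == s') && (x < y)) || ((s.+1 == s') && (y < x)).

Section BoxStatistics.

Variables k N : nat.
Implicit Types (B : {set 'I_k * 'I_N}) (p : 'I_k * 'I_N) (b : nat -> nat).

Definition height B j : nat := #|[set p in B | p.1 < j]|.

Definition colidx B p : nat := #|[set p' in B | (p'.1 == p.1) && (p'.2 < p.2)]|.

(* For b = diag_base r B, the value of delta at the box. *)
Definition box_pos b B p : nat := b p.1 + colidx B p.

Definition tdinv_boxes b B : nat :=
  \sum_(p in B) \sum_(p' in B)
    (att_pos p.1 (box_pos b B p) p'.1 (box_pos b B p') && (p.2 < p'.2)).

Definition attacks b B : nat :=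
  \sum_(p in B) \sum_(p' in B) att_pos p.1 (box_pos b B p) p'.1 (box_pos b B p').

Lemma lexrowE B p : lexrow B p = height B p.1 + colidx B p.
Proof.
rewrite -cardsUI [X in _ = _ + X]eq_card0 ?addn0; last first.
  by move=> p'; rewrite !inE; case: eqP => [->|]; rewrite ?ltnn ?andbF.
apply: eq_card => p'; rewrite !inE /lexlt.
by case: (p' \in B).
Qed.

(** The value of [delta] at the lowest point of the path on the vertical line through [x]; the
    truncation is harmless under [dyck_boxes]. *)
Definition diag_base r B (x : nat) : nat := height B x - r * x.

Definition dyck_boxes r B : bool := [forall j : 'I_k.+1, r * j <= height B j].

(** The cell of column [x] in the row of [p] has arm [p.1 - x - 1] and leg equal to [r] times the
    arm plus [box_pos p - diag_base x.+1]. After division by [k] the arm cancels from both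
    inequalities. *)
Definition pathdinv_boxes r B : nat :=
  \sum_(p in B) \sum_(x < k | x < p.1)
    ((diag_base r B x.+1 <= (box_pos (diag_base r B) B p).+1) &&
     (box_pos (diag_base r B) B p < diag_base r B x.+1 + r)).

Definition area_boxes r B : nat := \sum_(x < k) diag_base r B x.+1.

End BoxStatistics.

Section PathStatistics.

Variables (m k N : nat) (c : {ffun 'I_m -> 'I_k.+1}) (lab : {ffun 'I_m -> 'I_N}).
Hypothesis cl : labeled_path c lab.
Local Notation B := (boxset c lab).

Lemma heightE j : height B j = #|[set i | c i < j]|.
Proof. exact: height_boxset. Qed.

Lemma height_le j : height B j <= m.
Proof. by rewrite heightE -[X in _ <= X]card_ord max_card. Qed.

Lemma leq_heightB (i : 'I_m) j : (height B j <= i) = (j <= c i).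
Proof. by rewrite heightE (leq_height cl). Qed.

Lemma row_boxE (i : 'I_m) : height B (c i) + colidx B (box cl i) = i.
Proof. by rewrite -[RHS](lexrow_box cl) lexrowE. Qed.

Section Attack.
Variables (r : nat) (phi : nat -> nat) (b : nat -> nat).
Hypothesis phi_mono : forall x y, x < k -> y < k -> (phi x < phi y) = (x < y).
Hypothesis bE : forall x, x < k -> height B x = b x + r * phi x.

(** [phi] is the abscissa at which a column is drawn: the identity for rational parking functions,
    [width_sum] with [r = 1] for the spread path P'. Attacks only see the order of columns and the
    diagonals, so one statement serves both. *)
Lemma attackingE (i j : 'I_m) :
  attacking r (phi (c i), val i) (phi (c j), val j) =
  att_pos (c i) (box_pos b B (box cl i)) (c j) (box_pos b B (box cl j)).
Proof.
rewrite /attacking /att_pos /= !phi_mono ?(col_lt cl) //.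
have dE l : delta r (phi (c l), val l) = Posz (box_pos b B (box cl l)).
  rewrite /delta /= -[in X in Posz X](row_boxE l) bE ?(col_lt cl) // /box_pos /=; lia.
rewrite !dE; congr (_ && _ || _ && _); lia.
Qed.

Lemma tdinvE : tdinv r (fun i => phi (c i)) (vals lab) = tdinv_boxes b B.
Proof.
rewrite /tdinv (card_pairs (fun i j => attacking r (phi (c i), val i) (phi (c j), val j)
  && (vals lab i < vals lab j))).
rewrite /tdinv_boxes (big_boxset cl); apply: eq_bigr => i _.
rewrite (big_boxset cl); apply: eq_bigr => j _.
by rewrite attackingE.
Qed.

Lemma card_attacking :
  #|[set ij : 'I_m * 'I_m | attacking r (phi (c ij.1), val ij.1) (phi (c ij.2), val ij.2)]| =
  attacks b B.
Proof.
rewrite (card_pairs (fun i j => attacking r (phi (c i), val i) (phi (c j), val j))).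
rewrite /attacks (big_boxset cl); apply: eq_bigr => i _.
rewrite (big_boxset cl); apply: eq_bigr => j _.
by rewrite attackingE.
Qed.

End Attack.

End PathStatistics.

Section Wpf.

Variables k r N : nat.
Local Notation K := (k * r).
Implicit Types (D : {ffun 'I_K -> 'I_k.+1}) (lab : {ffun 'I_K -> 'I_N}).

Lemma is_wpfE D lab :
  is_wpf D lab = labeled_path D lab && [forall i : 'I_K, r * D i <= i].
Proof.
rewrite /is_wpf /is_dyck /labeled_path; case: (is_path D) => //=.
case: (boolP [forall i, r * D i <= i]) => [/forallP H|]; rewrite ?andbF //= andbT.
suff -> : [forall i, D i < k] by [].
apply/forallP=> i; have := leq_ltn_trans (H i) (ltn_ord i).
by rewrite mulnC ltn_mul2r => /andP[].
Qed.

Section OnePath.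
Variables (D : {ffun 'I_K -> 'I_k.+1}) (lab : {ffun 'I_K -> 'I_N}).
Hypothesis Dl : labeled_path D lab.
Local Notation B := (boxset D lab).

(** If the path were too low on a vertical line [j], the row numbered [height B j] would exist and
    lie in column [j] or later, hence below the line. *)
Lemma dyckE : [forall i : 'I_K, r * D i <= i] = dyck_boxes r B.
Proof.
apply/forallP/forallP => [H j|H i]; last first.
  by have := H (D i); move/leq_trans; apply; rewrite (leq_heightB Dl).
rewrite leqNgt; apply/negP=> lt.
have jk : r * j <= K by rewrite mulnC leq_mul2r -ltnS ltn_ord orbT.
have hK : height B j < K by apply: leq_trans jk.
have := leq_heightB Dl (Ordinal hK) j; rewrite leqnn => /esym jD.
have := H (Ordinal hK) => /=; rewrite leqNgt => /negP[]; apply: leq_trans lt _.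
by rewrite leq_mul2l jD orbT.
Qed.

Hypothesis dyck : dyck_boxes r B.

Lemma height_base x : x <= k -> height B x = diag_base r B x + r * x.
Proof. by move=> xk; rewrite /diag_base subnK // (forallP dyck (Ordinal (xk : x < k.+1))). Qed.

Lemma wpf_areaE : wpf_area D = area_boxes r B.
Proof.
rewrite /wpf_area (card_pairs (fun (x : 'I_k) (i : 'I_K) => (D i <= x) && (r * x.+1 <= i))).
apply: eq_bigr => x _; rewrite /diag_base -(@card_ord_itv K) ?height_le //.
rewrite -sum1_card [RHS]big_mkcond; apply: eq_bigr => i _; rewrite inE /=.
by rewrite andbC [_ < height _ _]ltnNge leq_heightB // -ltnNge ltnS; case: (_ && _).
Qed.

Lemma armE (x : 'I_k) i : arm D (x, i) = D i - x.+1.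
Proof.
rewrite -(@card_ord_itv k); last by rewrite -ltnS.
rewrite /arm -[RHS](card_imset _ (f := fun y : 'I_k => (y, i))); last by move=> ? ? [].
apply: eq_card => -[y j]; rewrite !inE /=; apply/idP/imsetP.
  by case/and3P=> yD /eqP E xy; exists y; rewrite ?inE -?E ?xy ?yD.
by case=> y'; rewrite inE => /andP[xy yD] [-> ->]; rewrite yD eqxx xy.
Qed.

Lemma legE (x : 'I_k) (i : 'I_K) : leg D (x, i) = i - height B x.+1.
Proof.
rewrite -(@card_ord_itv K) ?(ltnW (ltn_ord i)) //.
rewrite /leg -[RHS](card_imset _ (f := fun j : 'I_K => (x, j))); last by move=> ? ? [].
apply: eq_card => -[y j]; rewrite !inE /=; apply/idP/imsetP.
  case/and3P=> yD /eqP E ji; exists j; rewrite ?inE -?E //.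
  by rewrite leq_heightB // yD.
by case=> j'; rewrite inE leq_heightB // => /andP[xD ji] [-> ->]; rewrite xD eqxx ji.
Qed.

Lemma pathdinvE : 0 < k -> pathdinv D = pathdinv_boxes r B.
Proof.
move=> k_gt0; rewrite /pathdinv.
pose P (x : 'I_k) (i : 'I_K) := [&& x < D i, (D i - x.+1) * K <= k * (i - height B x.+1).+1 &
  k * (i - height B x.+1) < (D i - x.+1).+1 * K].
transitivity #|[set b : 'I_k * 'I_K | P b.1 b.2]|.
  by apply: eq_card => -[x i]; rewrite !inE /P armE legE.
rewrite card_pairs exchange_big /pathdinv_boxes (big_boxset Dl) /=.
apply: eq_bigr => i _; rewrite [RHS]big_mkcond; apply: eq_bigr => x _ /=.
rewrite /P /=; case: ifP => //= xD; congr (nat_of_bool _).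
have Dk := col_lt Dl i.
have hE := row_boxE Dl i; rewrite height_base ?(ltnW Dk) // in hE.
have hx := height_base (ltn_ord x).
have hle : height B x.+1 <= i by rewrite leq_heightB.
rewrite hx in hle *.
rewrite [_ * (k * r)]mulnCA leq_pmul2l // [_ * (k * r)]mulnCA ltn_pmul2l // /box_pos /=.
move: (diag_base r B x.+1) (diag_base r B (D i)) (colidx _ _) hE hle => bx bi s hE.
have [e De] : exists e, D i = x.+1 + e :> nat by exists (D i - x.+1); rewrite subnKC.
rewrite -hE De addKn mulnDr mulSn => hle.
have -> : bi + (r * x.+1 + r * e) + s - (bx + r * x.+1) = bi + s + r * e - bx by lia.
have {}hle : bx <= bi + s + r * e by lia.
rewrite [e * r]mulnC; move: (r * e) hle => re hle.
by congr (_ && _); apply/idP/idP; lia.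
Qed.

(* Labels increasing along the reading order (delta, column) make every
   attacking pair contribute. *)
Lemma maxtdinvE : maxtdinv D = attacks (diag_base r B) B.
Proof.
have mono x y : x < k -> y < k -> (x < y) = (x < y) by [].
have bE x : x < k -> height B x = diag_base r B x + r * x by move=> /ltnW/height_base.
rewrite -(card_attacking Dl mono bE); apply/eqP; rewrite eqn_leq; apply/andP; split.
  apply/bigmax_leqP=> l _; apply/subset_leq_card/subsetP=> ij; rewrite !inE.
  by case/andP.
pose L (i : 'I_K) := box_pos (diag_base r B) B (box Dl i) * k.+1 + D i.
have Ls : column_strict (vals D) L.
  apply/forallP=> i; apply/forallP=> j; apply/implyP=> /andP[ij /eqP E].
  have Hi := row_boxE Dl i; have Hj := row_boxE Dl j.
  have E' : D i = D j :> nat by [].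
  rewrite /L /box_pos /= E' ltn_add2r ltn_mul2r /= ltn_add2l.
  by rewrite -(ltn_add2l (height B (D j))) Hj -E' Hi.
apply: leq_trans (tdinv_le_max Ls); apply/subset_leq_card/subsetP=> -[i j].
rewrite !inE /= (attackingE Dl mono bE) => H; rewrite H /=.
move: H; rewrite /att_pos /L => /orP[/andP[/eqP -> ?]|/andP[/eqP <- _]]; first by rewrite ltn_add2l.
by have := col_lt Dl i; nia.
Qed.

End OnePath.

End Wpf.

Definition box_monomial k N (B : {set 'I_k * 'I_N}) : mpoly.mpoly N Qqt :=
  (\prod_(p in B) 'X_(p.2))%R.

Lemma wpf_series_boxes k r N : 0 < k ->
  wpf_series k r N =
  (\sum_(B : {set 'I_k * 'I_N} | (#|B| == k * r) && dyck_boxes r B)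
    (t ^+ area_boxes r B *
     q ^ ((pathdinv_boxes r B)%:Z + (tdinv_boxes (diag_base r B) B)%:Z
          - (attacks (diag_base r B) B)%:Z)) *: box_monomial B)%R.
Proof.
move=> k_gt0; rewrite /wpf_series; under eq_bigl do rewrite is_wpfE.
apply: (@big_labeled_path _ _ _ _ (fun D => [forall i : 'I_(k * r), r * D i <= i])
  (dyck_boxes r) (fun D (lab : {ffun 'I_(k * r) -> 'I_N}) =>
  (t ^+ wpf_area D * q ^ dinv D lab) *: \prod_(i < k * r) 'X_(lab i))%R) => [D lab Dl|D lab Dl].
  exact: (dyckE Dl).
rewrite (dyckE Dl) => dyck; rewrite (wpf_areaE Dl) /dinv (pathdinvE Dl) // (maxtdinvE Dl) //.
rewrite /box_monomial (big_boxset Dl) /=; congr ((_ * _ ^ (_ + Posz _ - _)) *: _)%R.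
by apply: (tdinvE Dl (phi := id)) => // x /ltnW; apply: height_base.
Qed.

(** * Stacked parking functions as box sets *)

Section Stacks.

Variables n k : nat.
Implicit Types (S : {ffun 'I_n -> 'I_k}) (c : {ffun 'I_n -> 'I_k.+1}).

Definition width_sum S j : nat := #|[set y : 'I_n | S y < j]|.

Section OneStack.
Variable S : {ffun 'I_n -> 'I_k}.
Hypothesis S_stack : is_stack S.

Lemma stack_mono (i j : 'I_n) : i <= j -> S i <= S j.
Proof. by case/andP: S_stack => /forallP H _; apply/implyP/(forallP (H i)). Qed.

Lemma leq_width_sum (i : 'I_n) j : (width_sum S j <= i) = (j <= S i).
Proof.
case: (leqP j (S i)) => [jc|cj]; last first.
  apply/negbTE; rewrite -ltnNge -[X in X <= _](@card_ord_lt n) //.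
  apply/subset_leq_card/subsetP=> i'; rewrite !inE ltnS => ii.
  exact: leq_ltn_trans (stack_mono ii) cj.
rewrite -[X in _ <= X](@card_ord_lt n) ?(ltnW (ltn_ord i)) //.
apply/subset_leq_card/subsetP=> i'; rewrite !inE => ci'; rewrite ltnNge.
by apply/negP=> /stack_mono; rewrite leqNgt (leq_trans ci' jc).
Qed.

Lemma width_sum_le j : width_sum S j <= n.
Proof. by rewrite -[X in _ <= X]card_ord max_card. Qed.

Lemma width_sumS (x : 'I_k) : width_sum S x.+1 = width_sum S x + stack_width S x.
Proof.
rewrite -cardsUI [X in _ = _ + X]eq_card0 ?addn0; last first.
  by move=> y; rewrite !inE; apply/negP => /andP[+ /eqP E]; rewrite E ltnn.
by apply: eq_card => y; rewrite !inE ltnS leq_eqVlt orbC.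
Qed.

Lemma stack_width_gt0 x : 0 < stack_width S x.
Proof.
case/andP: S_stack => _ /forallP/(_ x)/existsP[y Sy].
by apply/card_gt0P; exists y; rewrite inE.
Qed.

Lemma width_sum_mono x y : x < k -> y < k -> (width_sum S x < width_sum S y) = (x < y).
Proof.
have mono a b : a <= b -> width_sum S a <= width_sum S b.
  by move=> ab; apply/subset_leq_card/subsetP=> i; rewrite !inE => /leq_trans; apply.
move=> xk yk; case: (ltnP x y) => xy; last by apply/negbTE; rewrite -leqNgt mono.
apply: leq_trans (mono _ _ xy).
by rewrite -[x]/(val (Ordinal xk)) width_sumS -addn1 leq_add2l stack_width_gt0.
Qed.

Lemma width_sumE j : j <= k -> width_sum S j = \sum_(x < k | x < j) stack_width S x.
Proof.
elim: j => [|j IH] jk.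
  by rewrite big_pred0 //; apply: eq_card0 => y; rewrite inE.
have := width_sumS (Ordinal jk); rewrite /= => ->; rewrite IH ?(ltnW jk) //.
rewrite [RHS](bigD1 (Ordinal jk)) //= addnC; congr (_ + _).
by apply: eq_bigl => x; rewrite -val_eqE /= ltnS ltn_neqAle andbC.
Qed.

End OneStack.

Lemma is_wldE N S c (lab : {ffun 'I_n -> 'I_N}) :
  is_wld S c lab = is_stack S && (labeled_path c lab && [forall i, c i <= S i]).
Proof.
rewrite /is_wld /labeled_path; congr (_ && _); case: (is_path c) => //=.
case: (boolP [forall i, c i <= S i]) => [/forallP H|]; rewrite ?andbF //= andbT.
suff -> : [forall i, c i < k] by [].
by apply/forallP=> i; apply: leq_ltn_trans (H i) _.
Qed.

Variable N : nat.

Definition stack_base S (B : {set 'I_k * 'I_N}) x := height B x - width_sum S x.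

Definition above_stack S (B : {set 'I_k * 'I_N}) :=
  [forall j : 'I_k.+1, width_sum S j <= height B j].

Section OnePath.
Variables (S : {ffun 'I_n -> 'I_k}) (c : {ffun 'I_n -> 'I_k.+1}) (lab : {ffun 'I_n -> 'I_N}).
Hypotheses (S_stack : is_stack S) (cl : labeled_path c lab).
Local Notation B := (boxset c lab).

Lemma above_stackE : [forall i, c i <= S i] = above_stack S B.
Proof.
apply/forallP/forallP => [H j|H i]; last first.
  by rewrite -(leq_width_sum S_stack); apply: leq_trans (H (c i)) _; rewrite (leq_heightB cl).
rewrite leqNgt; apply/negP=> lt.
have hn : height B j < n by apply: leq_trans lt (width_sum_le S j).
have jc : j <= c (Ordinal hn) by rewrite -(leq_heightB cl).
by move: lt; rewrite ltnNge (leq_width_sum S_stack (Ordinal hn)) (leq_trans jc).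
Qed.

Hypothesis above : above_stack S B.

Lemma height_stack_base x : x <= k -> height B x = stack_base S B x + width_sum S x.
Proof. by move=> xk; rewrite /stack_base subnK // (forallP above (Ordinal (xk : x < k.+1))). Qed.

Lemma wld_areaE : wld_area S c = \sum_(x < k) stack_base S B x.+1.
Proof.
(* Every column of the stack is nonempty; for an empty column the left side would hold vacuously. *)
have E (b : 'I_k * 'I_n) : [forall y, (S y == b.1) ==> (y < b.2)] = (width_sum S b.1.+1 <= b.2).
  rewrite (leq_width_sum S_stack); apply/forallP/idP => [H|H y]; last first.
    apply/implyP=> /eqP Sy; rewrite ltnNge; apply/negP=> /(stack_mono S_stack).
    by rewrite Sy leqNgt H.
  have [y /eqP Sy] : exists y, S y == b.1.
    by case/andP: S_stack => _ /forallP/(_ b.1)/existsP.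
  have yb : y < b.2 by have := H y; rewrite Sy eqxx.
  have := stack_mono S_stack (ltnW yb); rewrite Sy leq_eqVlt => /orP[/eqP E|//].
  by have := H b.2; rewrite -val_eqE /= -E eqxx ltnn.
transitivity #|[set b : 'I_k * 'I_n | (c b.2 <= b.1) && (width_sum S b.1.+1 <= b.2)]|.
  by apply: eq_card => b; rewrite !inE E.
rewrite (card_pairs (fun (x : 'I_k) (i : 'I_n) => (c i <= x) && (width_sum S x.+1 <= i))).
apply: eq_bigr => x _; rewrite /stack_base -(@card_ord_itv n) ?(height_le cl) //.
rewrite -sum1_card [RHS]big_mkcond; apply: eq_bigr => i _; rewrite inE /=.
by rewrite andbC [_ < height _ _]ltnNge (leq_heightB cl) -ltnNge ltnS; case: (_ && _).
Qed.

(** In P' column [x] starts at abscissa [width_sum S x], so with slope one its first box lies on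
    diagonal [stack_base S B x]. *)
Lemma hdinvE : hdinv S c lab = tdinv_boxes (stack_base S B) B.
Proof.
rewrite -(tdinvE cl (r := 1) (width_sum_mono S_stack)); last first.
  by move=> x /ltnW xk; rewrite mul1n height_stack_base.
rewrite /hdinv /tdinv /spread; apply: eq_card => -[i j]; rewrite !inE /=.
by rewrite -!width_sumE // ltnW // (col_lt cl).
Qed.

End OnePath.

Lemma wld_series_boxes :
  wld_series n k N =
  (\sum_(S : {ffun 'I_n -> 'I_k} | is_stack S)
   \sum_(B : {set 'I_k * 'I_N} | (#|B| == n) && above_stack S B)
    (t ^+ (\sum_(x < k) stack_base S B x.+1)%N * q ^+ tdinv_boxes (stack_base S B) B)
      *: box_monomial B)%R.
Proof.
rewrite /wld_series.
transitivity (\sum_(S : {ffun 'I_n -> 'I_k} | is_stack S)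
  \sum_(P : {ffun 'I_n -> 'I_k.+1} * {ffun 'I_n -> 'I_N} |
         labeled_path P.1 P.2 && [forall i, (P.1 i <= S i)%N])
     (t ^+ wld_area S P.1 * q ^+ hdinv S P.1 P.2) *: \prod_(i < n) 'X_(P.2 i))%R.
  rewrite pair_big_dep /=.
  rewrite (reindex (fun p : {ffun 'I_n -> 'I_k} * ({ffun 'I_n -> 'I_k.+1} * {ffun 'I_n -> 'I_N})
    => (p.1, p.2.1, p.2.2))) /=; last first.
    by exists (fun p => (p.1.1, (p.1.2, p.2))) => [[? [? ?]]|[[? ?] ?]].
  by apply: eq_bigl => p; rewrite is_wldE.
apply: eq_bigr => S S_stack.
apply: (@big_labeled_path _ _ _ _ (fun c => [forall i, c i <= S i]) (above_stack S)
  (fun c (lab : {ffun 'I_n -> 'I_N}) => (t ^+ wld_area S c * q ^+ hdinv S c lab) *: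
     \prod_(i < n) 'X_(lab i))%R) => [c lab cl|c lab cl].
  exact: above_stackE.
rewrite (above_stackE S_stack cl) => above.
rewrite (wld_areaE S_stack cl) // (hdinvE S_stack cl) //.
by rewrite /box_monomial (big_boxset cl).
Qed.

Lemma stack_inj S S' : is_stack S -> is_stack S' ->
  (forall x, stack_width S x = stack_width S' x) -> S = S'.
Proof.
move=> HS HS' E; apply/ffunP=> i; apply/val_inj/eqP.
have W j : j <= k -> width_sum S j = width_sum S' j.
  by move=> jk; rewrite !width_sumE //; apply: eq_bigr.
rewrite eqn_leq -(leq_width_sum HS') -(W _ (ltnW (ltn_ord _))) (leq_width_sum HS) leqnn.
by rewrite -(leq_width_sum HS) (W _ (ltnW (ltn_ord _))) (leq_width_sum HS') leqnn.
Qed.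

(* A stack with columns of widths w is the path of the labeled path in which
   column x carries the labels 0, ..., w x - 1. *)
Lemma stack_exists (w : 'I_k -> nat) : (forall x, 0 < w x) -> \sum_x w x = n ->
  exists2 S : {ffun 'I_n -> 'I_k}, is_stack S & forall x, stack_width S x = w x.
Proof.
move=> w_gt0 wn.
have w_le x : w x <= n by rewrite -wn (bigD1 x) //= leq_addr.
pose B := [set p : 'I_k * 'I_n | p.2 < w p.1].
have cardB (x : 'I_k) : #|[set p in B | p.1 == x]| = w x.
  rewrite -[RHS](@card_ord_lt n) // -[RHS](card_imset _ (f := fun a : 'I_n => (x, a))).
    apply: eq_card => -[y a]; rewrite !inE /=; apply/andP/imsetP.
      by case=> aw /eqP <-; exists a; rewrite ?inE.
    by case=> a'; rewrite inE => aw [-> ->].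
  by move=> a a' [].
have [c [lab [cl cB]]] : exists c lab, @labeled_path n k n c lab /\ boxset c lab = B.
  apply: boxset_surj; rewrite -[RHS]wn -sum1_card (partition_big fst predT) //=.
  by apply: eq_bigr => x _; rewrite -cardB -sum1_card; apply: eq_bigl => p; rewrite inE.
pose S := [ffun i => Ordinal (col_lt cl i)].
have Sw x : stack_width S x = w x.
  rewrite -cardB -cB boxsetE /stack_width -(card_imset _ (@box_inj _ _ _ _ _ cl)).
  apply: eq_card => p; rewrite inE; apply/imsetP/andP => [[i]|[/imsetP[i _ ->]] E].
    by rewrite inE ffunE => E ->; rewrite imset_f.
  by exists i; rewrite ?inE ?ffunE.
exists S => //; apply/andP; split; last first.
  apply/forallP=> x; apply/existsP; move: (w_gt0 x); rewrite -Sw => /card_gt0P[y].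
  by rewrite inE; exists y.
have /and3P[/forallP path _ _] := cl.
apply/forallP=> i; apply/forallP=> j; apply/implyP=> ij; rewrite !ffunE /=.
exact: (implyP (forallP (path i) j)).
Qed.

End Stacks.

(** * Comparison of the statistics *)

Definition count_itv (a b c d : nat) : nat := \sum_(a <= s < b) (c <= s < d).

Definition imin (a c : nat) : int := Posz (minn a c).

(** [minn a c] counts the common elements of [0, a) and [0, c); the identity is inclusion-exclusion
    at the lower ends. *)
Lemma count_itvE a b c d : a <= b -> c <= d ->
  (Posz (count_itv a b c d) = imin b d - imin a d - imin b c + imin a c)%R.
Proof.
move=> ab cd; rewrite /count_itv /imin; elim: b ab => [|b IH] ab.
  by rewrite big_geq //; lia.
move: ab; rewrite leq_eqVlt => /orP[/eqP ->|]; first by rewrite big_geq //; lia.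
rewrite ltnS => ab; rewrite big_nat_recr //= PoszD IH //.
case: (leqP c b) => cb; case: (ltnP b d) => bd /=; lia.
Qed.

Lemma iminC a c : imin a c = imin c a.
Proof. by rewrite /imin minnC. Qed.

Lemma iminD r a c : (imin (a + r) (c + r) = imin a c + Posz r)%R.
Proof. by rewrite /imin -addn_minl. Qed.

Lemma imin0 a : imin a 0 = 0%R.
Proof. by rewrite /imin minn0. Qed.

(* Contributions of the columns i < j, whose boxes have delta in
   [b i, b (i+1) + r), the first extra letter of column i being at delta = g i. *)
Definition pathdinv_pair (b : nat -> nat) r i j :=
  count_itv (b j).+1 (b j.+1 + r).+1 (b i.+1) (b i.+1 + r).+1.
Definition attack_pair (b : nat -> nat) r i j :=
  count_itv (b i) (b i.+1 + r) (b j) (b j.+1 + r)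
  + count_itv (b j).+1 (b j.+1 + r).+1 (b i) (b i.+1 + r).
Definition mixed_pair (b g : nat -> nat) r i j :=
  count_itv (b i) (g i) (g j) (b j.+1 + r)
  + count_itv (b j).+1 (g j).+1 (g i) (b i.+1 + r).
(** The final key of a column is [b i.+1 + 1], so the keys of its copies run from [b i.+1 + 2] to
    [g i]; ties between columns go by index, whence the asymmetric bounds. *)
Definition sorted_pair (b g : nat -> nat) i j :=
  count_itv (b j.+1).+2 (g j).+1 0 (b i.+1).+1
  + count_itv (b i.+1).+2 (g i).+1 0 (b j.+1).+2.
(** Extra letters of one column lying under the extra letters of the other: the cases that neither
    [tdinv_big] nor [matrix_cost] records. *)
Definition low_pair (b g : nat -> nat) r i j :=
  count_itv (g j) (b j.+1 + r) 0 (g i) + count_itv (g i) (b i.+1 + r) 0 (g j).+1.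

Section Telescoping.

Variables (k r : nat) (b g : nat -> nat).
Hypotheses (b0 : b 0 = 0) (bk : b k = 0).
Hypothesis le_bg : forall x, x < k -> b x <= g x.
Hypothesis lt_bg : forall x, x < k -> b x.+1 < g x.
Hypothesis le_gb : forall x, x < k -> g x <= b x.+1 + r.

(* The pairwise defect is a discrete derivative of tele1 in i plus one of tele2
   in j; their boundary terms vanish because b 0 = b k = 0. *)
Definition tele1 x j : int :=
  (imin (b j).+1 (b x) - imin (b j.+1 + r).+1 (b x) + imin (b j) (b x) - imin (g j) (b x))%R.
Definition tele2 i y : int := (imin (b y).+1 (g i) - imin (b i.+1) (b y))%R.

Lemma pair_identity i j : i < k -> j < k ->
  (Posz (pathdinv_pair b r i j) + Posz (mixed_pair b g r i j) + Posz r - 1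
   - Posz (attack_pair b r i j) - Posz (sorted_pair b g i j) - Posz (low_pair b g r i j)
   = tele1 i.+1 j - tele1 i j + tele2 i j - tele2 i j.+1)%R.
Proof.
move=> ik jk.
have [bgi bgj] := (le_bg ik, le_bg jk); have [lti ltj] := (lt_bg ik, lt_bg jk).
have [gbi gbj] := (le_gb ik, le_gb jk).
rewrite /pathdinv_pair /mixed_pair /attack_pair /sorted_pair /low_pair /tele1 /tele2.
move: (b i) (b i.+1) (g i) (b j) (b j.+1) (g j) bgi bgj lti ltj gbi gbj.
move=> bi bi1 gi bj bj1 gj bgi bgj lti ltj gbi gbj.
rewrite !PoszD !count_itvE; try lia.
(* Common shifts are pulled out of the minima and symmetric ones identified; what remains is linear
   in them. *)
have S a c : (imin a.+1 c.+1 = imin a c + 1)%R by have := iminD 1 a c; rewrite !addn1.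
have r1 : (imin (bj1 + r).+1 (bi1 + r) = imin bj1.+1 bi1 + Posz r)%R by rewrite -addSn iminD.
rewrite !imin0 !S ?iminD r1.
move: (iminC bj1 bi1) (iminC bj (bi1 + r)) (iminC gi (bj1 + r)) (iminC gi gj) (iminC bi gj).
move: (iminC gj.+1 (bi1 + r)) (iminC bi bj) (iminC bj1.+1 gi) (iminC gi gj.+1) (iminC bi1 bj).
lia.
Qed.

(** At [x = 0] all minima are 0. On the diagonal [b j <= g j <= b j.+1 + r] makes each of the four
    minima equal to [b j], and the signs cancel. *)
Lemma sum_tele1 :
  (\sum_(j < k) \sum_(i < k | (i < j)%N) (tele1 i.+1 j - tele1 i j) = 0)%R.
Proof.
apply: big1 => j _; have jk := ltn_ord j.
rewrite -(big_ord_widen _ (fun i => tele1 i.+1 j - tele1 i j)%R (ltnW jk)).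
rewrite -(big_mkord predT (fun i => tele1 i.+1 j - tele1 i j)%R).
rewrite telescope_sumr // /tele1 b0 !imin0 /imin.
have := le_bg jk; have := le_gb jk; lia.
Qed.

(** Both ends of the telescope equal 1, on the diagonal by [b i.+1 < g i] and at [k] by
    [b k = 0]. *)
Lemma sum_tele2 :
  (\sum_(j < k) \sum_(i < k | (i < j)%N) (tele2 i j - tele2 i j.+1) = 0)%R.
Proof.
rewrite (exchange_big_dep predT) //=; apply: big1 => i _; have ik := ltn_ord i.
rewrite -(big_geq_mkord _ _ predT (fun j => tele2 i j - tele2 i j.+1)%R).
rewrite (telescope_sumr_eq (fun y => - tele2 i y)%R) //; last by move=> j _; rewrite opprK addrC.
rewrite /tele2 bk /imin.
have := lt_bg ik; lia.
Qed.

Lemma pair_sum :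
  \sum_(j < k) \sum_(i < k | i < j)
    (pathdinv_pair b r i j + mixed_pair b g r i j + r) =
  \sum_(j < k) \sum_(i < k | i < j)
    (attack_pair b r i j + sorted_pair b g i j + low_pair b g r i j).+1.
Proof.
pose psum (F : nat -> nat -> int) := (\sum_(j < k) \sum_(i < k | (i < j)%N) F i j)%R.
have E (F : nat -> nat -> nat) :
    Posz (\sum_(j < k) \sum_(i < k | i < j) F i j) = psum (fun i j => Posz (F i j)).
  rewrite (big_morph Posz PoszD (erefl _)); apply: eq_bigr => j _.
  by rewrite (big_morph Posz PoszD (erefl _)).
have sub (F G : nat -> nat -> int) : (psum F - psum G = psum (fun i j => F i j - G i j))%R.
  by rewrite /psum -sumrB; apply: eq_bigr => j _; rewrite sumrB.
apply/eqP; rewrite -eqz_nat -subr_eq0.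
rewrite (E (fun i j => pathdinv_pair b r i j + mixed_pair b g r i j + r)).
rewrite (E (fun i j => (attack_pair b r i j + sorted_pair b g i j + low_pair b g r i j).+1)).
rewrite sub; apply/eqP.
transitivity (psum (fun i j => (tele1 i.+1 j - tele1 i j) + (tele2 i j - tele2 i j.+1)))%R.
  apply: eq_bigr => j _; apply: eq_bigr => i _.
  have := pair_identity (ltn_ord i) (ltn_ord j); lia.
transitivity (psum (fun i j => tele1 i.+1 j - tele1 i j) + psum (fun i j => tele2 i j - tele2 i j.+1))%R.
  by rewrite /psum -big_split; apply: eq_bigr => j _; rewrite big_split.
by rewrite /psum sum_tele1 sum_tele2.
Qed.

End Telescoping.

(** * Extra letters against each other *)

Lemma sum_pairs k (F : 'I_k -> 'I_k -> nat) : (forall x, F x x = 0) ->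
  \sum_x \sum_y F x y = \sum_(j < k) \sum_(i < k | i < j) (F i j + F j i).
Proof.
move=> F0; under [RHS]eq_bigr do rewrite big_split.
rewrite big_split /= [X in _ = X + _](exchange_big_dep predT) //= -big_split /=.
apply: eq_bigr => x _; rewrite (bigID (fun y : 'I_k => x < y)) /=; congr (_ + _).
rewrite (bigD1 x) ?ltnn //= F0 add0n; apply: eq_bigl => y.
by rewrite -leqNgt ltn_neqAle -val_eqE andbC.
Qed.

Lemma big_ltS l (F : 'I_l -> nat) (m : 'I_l) :
  \sum_(m' < l | m' < m.+1) F m' = \sum_(m' < l | m' < m) F m' + F m.
Proof.
rewrite (bigD1 m) //= addnC; congr (_ + _); apply: eq_bigl => m'.
by rewrite ltnS ltn_neqAle andbC -val_eqE.
Qed.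

(** Selected elements occupy consecutive positions from [c] on; applied both to the boxes of a
    column and to its extra letters. *)
Lemma sum_rank l (A : pred 'I_l) c (f : nat -> nat) m : m <= l ->
  \sum_(m' < l | m' < m) A m' * f (c + \sum_(m'' < l | m'' < m') A m'') =
  \sum_(c <= s < c + \sum_(m' < l | m' < m) A m') f s.
Proof.
elim: m => [|m IH] ml.
  have E0 (F : 'I_l -> nat) : \sum_(m' < l | m' < 0) F m' = 0 by rewrite big_pred0.
  by rewrite !E0 addn0 big_geq.
rewrite !(big_ltS _ (Ordinal ml)) IH ?(ltnW ml) //=.
case: (A _) => /=; last by rewrite !addn0.
by rewrite mul1n addnA addn1 big_nat_recr // leq_addr.
Qed.

Section BigLetters.

Variables (k l : nat) (M : {ffun 'I_l -> {set 'I_k}}) (g : nat -> nat).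

Definition missing (x : 'I_k) (m : nat) : nat := \sum_(m' < l | m' < m) (x \in M m').

(** If column [x] omits [m], this is the diagonal on which [m] would have been placed. *)
Definition bigpos (x : 'I_k) (m : nat) : nat := g x + \sum_(m' < l | m' < m) (x \notin M m').

Definition tdinv_big : nat :=
  \sum_x \sum_(m < l | x \notin M m) \sum_y \sum_(m' < l | y \notin M m')
    (att_pos x (bigpos x m) y (bigpos y m') && (m < m')).

Lemma bigpos_ge (x : 'I_k) m : g x <= bigpos x m.
Proof. exact: leq_addr. Qed.

Lemma sum_bigpos (x : 'I_k) m (f : nat -> nat) : m <= l ->
  \sum_(m' < l | m' < m) (x \notin M m') * f (bigpos x m') =
  \sum_(g x <= s < bigpos x m) f s.
Proof. exact: (sum_rank (fun m' => x \notin M m')). Qed.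

Lemma sum_eq_itv a b p : \sum_(a <= s < b) (s == p) = (a <= p < b).
Proof.
case: (leqP a b) => [ab|ba]; last by rewrite big_geq ?(ltnW ba) //; lia.
elim: b ab => [|b IH] ab; first by rewrite big_geq //; lia.
move: ab; rewrite leq_eqVlt => /orP[/eqP ->|]; first by rewrite big_geq //; lia.
rewrite ltnS => ab; rewrite big_nat_recr //= IH // ltnS.
by case: (ltngtP b p) => [bp|pb|<-]; rewrite ?andbF ?andbT ?addn0 ?ab.
Qed.

(** The extra letters of column [x] below [m'] fill the diagonals from [g x] to just before
    [bigpos x m'], and at most one of them attacks diagonal [p] of column [y]. *)
Lemma att_big (x y : 'I_k) (m' : nat) p : m' <= l ->
  \sum_(m < l | x \notin M m) (att_pos x (bigpos x m) y p && (m < m')) =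
  (x < y) * (g x <= p < bigpos x m') + (y < x) * (g x < p <= bigpos x m').
Proof.
move=> ml; rewrite -sum_eq_itv -(sum_bigpos x (fun s => s == p)) //.
have -> : (g x < p <= bigpos x m') = \sum_(g x <= s < bigpos x m') (s.+1 == p) :> nat.
  case: p => [|p]; first by rewrite big1.
  by rewrite -sum_eq_itv.
rewrite -(sum_bigpos x (fun s => s.+1 == p)) // !big_distrr /= -big_split /=.
rewrite big_mkcond [RHS]big_mkcond; apply: eq_bigr => m _.
case: (x \in M m) => /=; first by rewrite !muln0; case: ifP.
rewrite /att_pos; case: (m < m'); rewrite ?andbT ?andbF // !mul1n.
by case: (ltngtP x y); case: eqP; case: eqP => //; lia.
Qed.

Lemma tdinv_big_pairs : tdinv_big =
  \sum_(j < k) \sum_(i < k | i < j) \sum_(m < l)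
    ((j \notin M m) * (g i <= bigpos j m < bigpos i m) +
     (i \notin M m) * (g j < bigpos i m <= bigpos j m)).
Proof.
transitivity (\sum_(x < k) \sum_(y < k) \sum_(m < l) (y \notin M m) *
   ((x < y) * (g x <= bigpos y m < bigpos x m) + (y < x) * (g x < bigpos y m <= bigpos x m))).
  rewrite /tdinv_big; apply: eq_bigr => x _; rewrite exchange_big /=; apply: eq_bigr => y _.
  rewrite exchange_big /= big_mkcond; apply: eq_bigr => m' _.
  by case: (y \in M m') => //=; rewrite mul1n att_big // ltnW.
rewrite sum_pairs => [|x]; last by rewrite big1 // => m _; rewrite !ltnn muln0.
apply: eq_bigr => j _; apply: eq_bigr => i ij; rewrite -big_split; apply: eq_bigr => m _ /=.
have ji : (j < i) = false by apply/negbTE; rewrite -leqNgt ltnW.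
by rewrite ij ji /= !mul1n !mul0n addn0 add0n.
Qed.

Definition gstart : {ffun 'I_k -> int} := [ffun x : 'I_k => Posz (g x)].

(** The shift by [m] is the same for all columns, so comparing keys amounts to comparing positions
    of the letter [m]. *)
Lemma stage_bigpos (x : 'I_k) (m : 'I_l) : (stage gstart M m x + Posz m = Posz (bigpos x m))%R.
Proof.
have E : missing x m + \sum_(m' < l | m' < m) (x \notin M m') = m.
  rewrite -big_split /= (eq_bigr (fun=> 1)); last by move=> m' _; case: (x \in _).
  by rewrite sum1_card -[RHS](@card_ord_lt l) ?(ltnW (ltn_ord m)) //; apply: eq_card => m'; rewrite !inE.
rewrite !ffunE /bigpos -/(missing x m); lia.
Qed.

Lemma matrix_cost_pairs : matrix_cost gstart M =
  \sum_(j < k) \sum_(i < k | i < j) \sum_(m < l)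
    ((j \in M m) * (bigpos j m < bigpos i m) + (i \in M m) * (bigpos i m <= bigpos j m)).
Proof.
transitivity (\sum_(x < k) \sum_(y < k) \sum_(m < l) (x \in M m) *
   ((y < x) * (bigpos x m < bigpos y m) + (x < y) * (bigpos x m <= bigpos y m))).
  rewrite /matrix_cost; transitivity (\sum_(m < l) \sum_(x < k) \sum_(y < k) (x \in M m) *
   ((y < x) * (bigpos x m < bigpos y m) + (x < y) * (bigpos x m <= bigpos y m))).
    apply: eq_bigr => m _; rewrite big_mkcond; apply: eq_bigr => x _.
    case: (x \in M m); last by rewrite big1.
    rewrite /key_rank -sum1_card big_mkcond; apply: eq_bigr => y _; rewrite inE mul1n.
    have := stage_bigpos x m; have := stage_bigpos y m.
    rewrite /key_below; move: (stage _ _ _ x) (stage _ _ _ y) => a b Hb Ha.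
    have -> : (a < b)%R = (bigpos x m < bigpos y m) by lia.
    have -> : (a == b) = (bigpos x m == bigpos y m) by lia.
    case: (ltngtP y x) => [xy|xy|/val_inj ->]; last by rewrite !ltnn eqxx.
      by case: (ltngtP (bigpos x m) (bigpos y m)).
    by case: (ltngtP (bigpos x m) (bigpos y m)).
  rewrite exchange_big; apply: eq_bigr => x _; exact: exchange_big.
rewrite sum_pairs => [|x]; last by rewrite big1 // => m _; rewrite !ltnn muln0.
apply: eq_bigr => j _; apply: eq_bigr => i ij; rewrite -big_split; apply: eq_bigr => m _ /=.
have ji : (j < i) = false by apply/negbTE; rewrite -leqNgt ltnW.
by rewrite ij ji /= !mul1n !mul0n addn0 add0n addnC.
Qed.

(* A pair of columns and a letter m omitted by neither contribute to tdinv_big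
   according to which of the two positions is higher; an omission is charged
   to matrix_cost in the same case. *)
Lemma big_letters :
  tdinv_big + matrix_cost gstart M +
  \sum_(j < k) \sum_(i < k | i < j)
     (count_itv (g j) (bigpos j l) 0 (g i) + count_itv (g i) (bigpos i l) 0 (g j).+1) =
  \sum_(j < k) \sum_(i < k | i < j) l.
Proof.
rewrite tdinv_big_pairs matrix_cost_pairs -!big_split; apply: eq_bigr => j _ /=.
rewrite -!big_split; apply: eq_bigr => i ij /=.
have cE (x : 'I_k) c : count_itv (g x) (bigpos x l) 0 c = \sum_(m < l) (x \notin M m) * (bigpos x m < c).
  rewrite /count_itv /= -(sum_bigpos x (fun s => s < c)) //.
  by apply: eq_bigl => m; rewrite ltn_ord.
rewrite !cE -!big_split -[RHS]card_ord -sum1_card; apply: eq_bigr => m _ /=.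
have := bigpos_ge i m; have := bigpos_ge j m.
case: (j \in M m); case: (i \in M m) => /=; lia.
Qed.

End BigLetters.

(** * Joining small labels and extra letters *)

Lemma big_boxes k N (R : Type) (idx : R) (op : Monoid.com_law idx)
    (B : {set 'I_k * 'I_N}) (G : 'I_k * 'I_N -> R) :
  \big[op/idx]_(p in B) G p =
  \big[op/idx]_(x < k) \big[op/idx]_(a < N | (x, a) \in B) G (x, a).
Proof. by rewrite pair_big_dep; apply: eq_big => [[x a]|[x a]]. Qed.

Section ColumnSums.

Variables (k N : nat) (B : {set 'I_k * 'I_N}).

Definition col_size (x : nat) : nat := #|[set p in B | p.1 == x :> nat]|.

Lemma col_sizeE (x : 'I_k) : col_size x = \sum_(a < N) ((x, a) \in B).
Proof.
rewrite /col_size -sum1_card (eq_bigl (fun p => (p \in B) && (p.1 == x))); last first.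
  by move=> p; rewrite inE.
rewrite big_mkcondr /= big_boxes (bigD1 x) //= [X in _ + X]big1 ?addn0.
  by rewrite [LHS]big_mkcond; apply: eq_bigr => a _; rewrite eqxx; case: (_ \in B).
by move=> y yx; rewrite big1 // => a _; rewrite (negbTE yx).
Qed.

Lemma heightS x : height B x.+1 = height B x + col_size x.
Proof.
rewrite -cardsUI [X in _ = _ + X]eq_card0 ?addn0; last first.
  by move=> p; rewrite !inE; apply/negP => /andP[/andP[_ +] /andP[_ /eqP E]]; rewrite E ltnn.
by apply: eq_card => p; rewrite !inE ltnS leq_eqVlt orbC; case: (p \in B).
Qed.

Lemma height0 : height B 0 = 0.
Proof. by apply: eq_card0 => p; rewrite !inE ltn0 andbF. Qed.

Lemma height_full : height B k = #|B|.
Proof. by apply: eq_card => p; rewrite inE ltn_ord andbT. Qed.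

Lemma colidxE (x : 'I_k) (a : 'I_N) :
  colidx B (x, a) = \sum_(a' < N | a' < a) ((x, a') \in B).
Proof.
rewrite /colidx -sum1_card (eq_bigl (fun p => (p \in B) && ((p.1 == x) && (p.2 < a)))); last first.
  by move=> p; rewrite inE.
rewrite big_mkcondr /= big_boxes (bigD1 x) //= [X in _ + X]big1 ?addn0.
  rewrite big_mkcond [RHS]big_mkcond; apply: eq_bigr => a' _; rewrite eqxx.
  by case: (_ \in B); case: ifP.
by move=> y yx; rewrite big1 // => a' _; rewrite (negbTE yx).
Qed.

Lemma sum_pos (b : nat -> nat) (f : nat -> nat -> nat) :
  \sum_(p in B) f p.1 (box_pos b B p) =
  \sum_(x < k) \sum_(b x <= s < b x + col_size x) f x s.
Proof.
rewrite big_boxes; apply: eq_bigr => x _ /=.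
have lt_full (F : 'I_N -> nat) : \sum_(a < N) F a = \sum_(a < N | a < N) F a.
  by apply: eq_bigl => a; rewrite ltn_ord.
rewrite col_sizeE lt_full -(sum_rank (fun a => (x, a) \in B)) //.
rewrite big_mkcond [RHS]big_mkcond; apply: eq_bigr => a _; rewrite ltn_ord.
by rewrite /box_pos colidxE; case: (_ \in B); rewrite ?mul1n.
Qed.

End ColumnSums.

Lemma sum_rev_itv a d (F : nat -> nat) :
  \sum_(a <= s < d + a) F s = \sum_(e < d) F (d - e.+1 + a).
Proof.
by rewrite -{1}[a]add0n big_addn addnK big_mkord (reindex_inj rev_ord_inj).
Qed.

Section Intervals.

Variable k : nat.

Lemma sum_att (al be ga de : nat -> nat) :
  \sum_(x < k) \sum_(al x <= s < be x) \sum_(y < k) \sum_(ga y <= s' < de y) att_pos x s y s' =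
  \sum_(j < k) \sum_(i < k | i < j)
    (count_itv (al i) (be i) (ga j) (de j) + count_itv (al j).+1 (be j).+1 (ga i) (de i)).
Proof.
transitivity (\sum_(x < k) \sum_(y < k) ((x < y) * count_itv (al x) (be x) (ga y) (de y) +
   (y < x) * count_itv (al x).+1 (be x).+1 (ga y) (de y))).
  apply: eq_bigr => x _; rewrite exchange_big /=; apply: eq_bigr => y _.
  rewrite /count_itv big_add1 /= !big_distrr -big_split /=; apply: eq_bigr => s _.
  rewrite -!sum_eq_itv !big_distrr -big_split; apply: eq_bigr => s' _ /=.
  rewrite /att_pos ![_ == s']eq_sym.
  by case: (ltngtP x y); case: eqP; case: eqP => //; lia.
rewrite sum_pairs => [|x]; last by rewrite !ltnn.
apply: eq_bigr => j _; apply: eq_bigr => i ij.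
have ji : (j < i) = false by apply/negbTE; rewrite -leqNgt ltnW.
by rewrite ij ji !mul1n !mul0n addn0.
Qed.

Lemma sorted_cost_pairs (b g : nat -> nat) (d : {ffun 'I_k -> nat}) :
  (forall x : 'I_k, g x = b x.+1 + (d x).+1) ->
  sorted_cost [ffun x : 'I_k => Posz (g x)] d =
  \sum_(j < k) \sum_(i < k | i < j) sorted_pair b g i j.
Proof.
move=> gE; rewrite /sorted_cost.
transitivity (\sum_(x < k) \sum_(y < k)
  ((y < x) * count_itv (b x.+1).+2 (g x).+1 0 (b y.+1).+1
   + (x < y) * count_itv (b x.+1).+2 (g x).+1 0 (b y.+1).+2)).
  apply: eq_bigr => x _.
  have -> : \sum_(e < d x) last_above [ffun x : 'I_k => Posz (g x)] d ([ffun x : 'I_k => Posz (g x)] x - Posz e)%R x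
    = \sum_((b x.+1).+2 <= s < (g x).+1) \sum_(y < k)
        ((y < x) * (s < (b y.+1).+1) + (x < y) * (s < (b y.+1).+2)).
    rewrite gE (_ : (b x.+1 + (d x).+1).+1 = d x + (b x.+1).+2); last by lia.
    rewrite sum_rev_itv.
    apply: eq_bigr => e _; rewrite /last_above -sum1_card big_mkcond; apply: eq_bigr => y _.
    rewrite inE !ffunE !gE /key_below; have := ltn_ord e => le.
    have -> : (Posz (b x.+1 + (d x).+1) - Posz e < Posz (b y.+1 + (d y).+1) - Posz (d y))%R =
       (d x - e.+1 + (b x.+1).+2 < (b y.+1).+1) by lia.
    have -> : (Posz (b x.+1 + (d x).+1) - Posz e == Posz (b y.+1 + (d y).+1) - Posz (d y))%R =
       (d x - e.+1 + (b x.+1).+2 == (b y.+1).+1) by lia.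
    case: (ltngtP x y) => [xy|xy|/val_inj <-].
    - rewrite andbT mul0n mul1n add0n [in RHS]ltnS [in RHS]leq_eqVlt orbC.
      by case: ifP.
    - by rewrite andbF orbF addn0 mul1n; case: ifP.
    - by rewrite andbF orbF ifF //; apply/negbTE; rewrite -leqNgt; lia.
  rewrite exchange_big /=; apply: eq_bigr => y _.
  by rewrite big_split -!big_distrr.
rewrite sum_pairs => [|x]; last by rewrite !ltnn.
apply: eq_bigr => j _; apply: eq_bigr => i ij.
have ji : (j < i) = false by apply/negbTE; rewrite -leqNgt ltnW.
by rewrite ij ji !mul1n !mul0n addn0 addnC.
Qed.

End Intervals.

Section Join.

Variables (k N l : nat) (Bs : {set 'I_k * 'I_N}) (M : {ffun 'I_l -> {set 'I_k}}).

(* Parking function with the small labels of Bs and l larger labels, the m-th of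
   which is in all columns outside M m. *)
Definition join_boxes : {set 'I_k * 'I_(N + l)} :=
  [set p | match split p.2 with inl a => (p.1, a) \in Bs | inr m => p.1 \notin M m end].

Local Notation B := join_boxes.

Lemma in_join_small x a : ((x, lshift l a) \in B) = ((x, a) \in Bs).
Proof. by rewrite inE /= (unsplitK (inl a)). Qed.

Lemma in_join_big x m : ((x, rshift N m) \in B) = (x \notin M m).
Proof. by rewrite inE /= (unsplitK (inr m)). Qed.

Lemma big_join (R : Type) (idx : R) (op : Monoid.com_law idx) (G : 'I_k * 'I_(N + l) -> R) :
  \big[op/idx]_(p in B) G p =
  op (\big[op/idx]_(p in Bs) G (p.1, lshift l p.2))
     (\big[op/idx]_(x < k) \big[op/idx]_(m < l | x \notin M m) G (x, rshift N m)).
Proof.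
rewrite !big_boxes -big_split; apply: eq_bigr => x _.
rewrite big_mkcond big_split_ord /=; congr (op _ _).
  by rewrite [RHS]big_mkcond; apply: eq_bigr => a _; rewrite in_join_small.
by rewrite [RHS]big_mkcond; apply: eq_bigr => m _; rewrite in_join_big.
Qed.

Local Notation d := (column_sum M).

Lemma column_sum_le x : d x <= l.
Proof.
rewrite ffunE -[X in _ <= X]card_ord -sum1_card; apply: leq_sum => m _.
exact: leq_b1.
Qed.

Lemma sum_notin (x : 'I_k) : \sum_(m < l) (x \notin M m) + d x = l.
Proof.
rewrite ffunE -big_split /= -[RHS]card_ord -sum1_card; apply: eq_bigr => m _.
by case: (_ \in _).
Qed.

Lemma col_size_join (x : 'I_k) : col_size B x + d x = col_size Bs x + l.
Proof.
rewrite !col_sizeE big_split_ord /= -addnA -[in RHS](sum_notin x); congr (_ + (_ + _)).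
  by apply: eq_bigr => a _; rewrite in_join_small.
by apply: eq_bigr => m _; rewrite in_join_big.
Qed.

Lemma height_join j : j <= k ->
  height B j + \sum_(x < k | x < j) d x = height Bs j + l * j.
Proof.
elim: j => [|j IH] jk; first by rewrite !height0 big_pred0 ?muln0.
rewrite !heightS (big_ltS d (Ordinal jk)) mulnS.
have := col_size_join (Ordinal jk); have := IH (ltnW jk) => /=; lia.
Qed.

Lemma card_join : #|B| + \sum_x d x = #|Bs| + l * k.
Proof.
rewrite -!height_full -height_join //; congr (_ + _).
by apply: eq_bigl => x; rewrite ltn_ord.
Qed.

Local Notation b := (diag_base l.+1 B).
Definition big_start (x : nat) : nat := b x + col_size Bs x.
Local Notation g := big_start.

Lemma pos_join_small p : box_pos b B (p.1, lshift l p.2) = box_pos b Bs p.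
Proof.
case: p => x a; rewrite /box_pos /= !colidxE big_mkcond big_split_ord /=.
rewrite [X in _ + (_ + X)]big1 ?addn0 => [|m _]; last first.
  by rewrite ifN // -leqNgt (leq_trans (ltnW (ltn_ord a))) ?leq_addr.
by rewrite [in RHS]big_mkcond; congr (_ + _); apply: eq_bigr => a' _; rewrite in_join_small.
Qed.

Lemma pos_join_big (x : 'I_k) m : box_pos b B (x, rshift N m) = bigpos M g x m.
Proof.
rewrite /box_pos /bigpos /big_start /= colidxE big_mkcond big_split_ord /= -addnA; congr (_ + (_ + _)).
  rewrite col_sizeE; apply: eq_bigr => a _; rewrite in_join_small ifT //.
  by rewrite (leq_trans (ltn_ord a)) // leq_addr.
by rewrite [in RHS]big_mkcond; apply: eq_bigr => m' _; rewrite in_join_big ltn_add2l.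
Qed.

Lemma bigpos_l (x : 'I_k) : bigpos M g x l + d x = g x + l.
Proof.
rewrite /bigpos -addnA; congr (_ + _); rewrite -[RHS](sum_notin x); congr (_ + _).
by apply: eq_bigl => m; rewrite ltn_ord.
Qed.

Lemma sum_bigpos_full (x : 'I_k) (f : nat -> nat) :
  \sum_(m < l | x \notin M m) f (bigpos M g x m) = \sum_(g x <= s < bigpos M g x l) f s.
Proof.
rewrite -sum_bigpos // big_mkcond [RHS]big_mkcond; apply: eq_bigr => m _.
by rewrite ltn_ord; case: (x \in M m); rewrite ?mul1n.
Qed.

(** Every small label is less than every extra one, so the mixed pairs contribute in one direction
    only, and there each attack counts. *)
Lemma tdinv_join :
  tdinv_boxes b B = tdinv_boxes b Bs
   + \sum_(j < k) \sum_(i < k | i < j) 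
      (count_itv (b i) (g i) (g j) (bigpos M g j l)
       + count_itv (b j).+1 (g j).+1 (g i) (bigpos M g i l))
   + tdinv_big M g.
Proof.
rewrite {1}/tdinv_boxes big_join /=; congr (_ + _); last first.
  apply: eq_bigr => x _; apply: eq_bigr => m xm.
  rewrite big_join /= big1 ?add0n => [|p _]; last first.
    by rewrite andbC ltnNge (leq_trans (ltnW (ltn_ord p.2))) ?leq_addr.
  by apply: eq_bigr => y _; apply: eq_bigr => m' _; rewrite !pos_join_big ltn_add2l.
under eq_bigr do rewrite big_join; rewrite big_split /=; congr (_ + _).
  by apply: eq_bigr => p _; apply: eq_bigr => p' _; rewrite !pos_join_small.
(* [sum_att] takes functions on all natural numbers; the value 0 outside the columns is a filler. *)
pose t y := if insub y is Some y' then bigpos M g y' l else 0.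
have tE (y : 'I_k) : t y = bigpos M g y l by rewrite /t valK.
pose f x s := \sum_(y < k) \sum_(g y <= s' < t y) (att_pos x s y s' : nat).
transitivity (\sum_(p in Bs) f p.1 (box_pos b Bs p)).
  apply: eq_bigr => p _; apply: eq_bigr => y _; rewrite tE -sum_bigpos_full.
  apply: eq_bigr => m _; rewrite pos_join_big pos_join_small.
  by rewrite (leq_trans (ltn_ord p.2)) ?leq_addr // andbT.
rewrite sum_pos (sum_att _ b g g t); apply: eq_bigr => j _; apply: eq_bigr => i _.
by rewrite !tE.
Qed.

Hypotheses (dyck : dyck_boxes l.+1 B) (cardB : #|B| = k * l.+1).

Lemma diag_base0 : b 0 = 0.
Proof. by rewrite /diag_base height0. Qed.

Lemma diag_base_full : b k = 0.
Proof. by rewrite /diag_base height_full cardB mulnC subnn. Qed.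

Lemma diag_base_step (x : 'I_k) : b x.+1 + l.+1 = b x + col_size B x.
Proof.
have dy j : j <= k -> l.+1 * j <= height B j.
  by move=> jk; apply: (forallP dyck (Ordinal (jk : j < k.+1))).
have := dy x (ltnW (ltn_ord x)); have := dy x.+1 (ltn_ord x).
rewrite /diag_base heightS mulnS; lia.
Qed.

(** Column [x] ends on diagonal [b x.+1 + l.+1], and its top [l - d x] boxes hold extra letters. *)
Lemma big_startE (x : 'I_k) : g x = b x.+1 + (d x).+1.
Proof. rewrite /big_start; have := diag_base_step x; have := col_size_join x; lia. Qed.

Lemma bigpos_end (x : 'I_k) : bigpos M g x l = b x.+1 + l.+1.
Proof. by have := bigpos_l x; rewrite big_startE; lia. Qed.

Lemma attacks_join : attacks b B = \sum_(j < k) \sum_(i < k | i < j) attack_pair b l.+1 i j.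
Proof.
pose t x := b x + col_size B x.
have tE (x : 'I_k) : t x = b x.+1 + l.+1 by rewrite diag_base_step.
pose f x s := \sum_(y < k) \sum_(b y <= s' < t y) (att_pos x s y s' : nat).
transitivity (\sum_(p in B) f p.1 (box_pos b B p)).
  by apply: eq_bigr => p _; rewrite (sum_pos B b (fun y s' => att_pos p.1 (box_pos b B p) y s')).
rewrite sum_pos (sum_att _ b t b t); apply: eq_bigr => j _; apply: eq_bigr => i _.
by rewrite !tE.
Qed.

Lemma pathdinv_join :
  pathdinv_boxes l.+1 B = \sum_(j < k) \sum_(i < k | i < j) pathdinv_pair b l.+1 i j.
Proof.
pose f y s := \sum_(x < k | x < y) ((b x.+1 <= s.+1) && (s < b x.+1 + l.+1) : nat).
rewrite /pathdinv_boxes (sum_pos B b f); apply: eq_bigr => j _.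
rewrite exchange_big /=; apply: eq_bigr => i _.
rewrite /pathdinv_pair /count_itv (diag_base_step j) [RHS]big_add1 /=.
by apply: eq_bigr => s _; rewrite ltnS.
Qed.

(** The sum of [big_letters] and [pair_sum]: the [low_pair] terms and the constants per pair
    cancel. *)
Lemma box_statistics :
  pathdinv_boxes l.+1 B + tdinv_boxes b B + matrix_cost (gstart k g) M =
  attacks b B + tdinv_boxes b Bs + sorted_cost (gstart k g) d.
Proof.
rewrite tdinv_join attacks_join pathdinv_join (sorted_cost_pairs big_startE).
have := big_letters M g.
have ps : \sum_(j < k) \sum_(i < k | i < j)
    (pathdinv_pair b l.+1 i j + mixed_pair b g l.+1 i j + l.+1) =
  \sum_(j < k) \sum_(i < k | i < j)
    (attack_pair b l.+1 i j + sorted_pair b g i j + low_pair b g l.+1 i j).+1.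
  have H x (xk : x < k) := (big_startE (Ordinal xk), column_sum_le (Ordinal xk)).
  apply: pair_sum => [||x xk|x xk|x xk]; first exact: diag_base0.
  - exact: diag_base_full.
  - exact: leq_addr.
  - by have [/= -> _] := H x xk; rewrite addnS ltnS leq_addr.
  - by have [/= -> ?] := H x xk; rewrite leq_add2l.
have lowE : \sum_(j < k) \sum_(i < k | i < j)
     (count_itv (g j) (bigpos M g j l) 0 (g i) + count_itv (g i) (bigpos M g i l) 0 (g j).+1) =
  \sum_(j < k) \sum_(i < k | i < j) low_pair b g l.+1 i j.
  by apply: eq_bigr => j _; apply: eq_bigr => i _; rewrite !bigpos_end.
have mixE : \sum_(j < k) \sum_(i < k | i < j) 
      (count_itv (b i) (g i) (g j) (bigpos M g j l)
       + count_itv (b j).+1 (g j).+1 (g i) (bigpos M g i l)) =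
  \sum_(j < k) \sum_(i < k | i < j) mixed_pair b g l.+1 i j.
  by apply: eq_bigr => j _; apply: eq_bigr => i _; rewrite !bigpos_end.
rewrite lowE mixE; move: ps.
have sD (F G : 'I_k -> 'I_k -> nat) :
   \sum_(j < k) \sum_(i < k | i < j) (F i j + G i j) =
   \sum_(j < k) \sum_(i < k | i < j) F i j + \sum_(j < k) \sum_(i < k | i < j) G i j.
  by rewrite -big_split; apply: eq_bigr => j _; rewrite big_split.
under [X in _ = X -> _]eq_bigr do under eq_bigr do rewrite -addnS.
rewrite !sD.
have sS (F : 'I_k -> 'I_k -> nat) :
   \sum_(j < k) \sum_(i < k | i < j) (F i j).+1 =
   \sum_(j < k) \sum_(i < k | i < j) F i j + \sum_(j < k) \sum_(i < k | i < j) 1.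
  by rewrite -sD; apply: eq_bigr => j _; apply: eq_bigr => i _; rewrite addn1.
rewrite (sS (fun i j => low_pair b g l.+1 i j)) (sS (fun=> fun=> l)).
rewrite (sD (fun i j => count_itv (g j) (b j.+1 + l.+1) 0 (g i))
  (fun i j => count_itv (g i) (b i.+1 + l.+1) 0 (g j).+1)).
lia.
Qed.

End Join.

(** * The skewing formula *)

Lemma hexp_le c n l x e : x \in hexp c n l -> e \in x.2 -> e <= c.+1.
Proof.
elim: n l x => [|n IH] [|l] x; try by rewrite inE => /eqP ->.
rewrite hexpS => /flattenP[s /mapP[m _ ->]] /mapP[y /IH yP ->] /=.
rewrite mem_cat inE mem_nseq => /or3P[/andP[_ /eqP ->] //|/eqP ->|/yP //].
by rewrite (leq_trans (leq_subr _ _)).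
Qed.

Lemma hexp_sum c n l x : l <= n -> x \in hexp c n l -> \sum_(e <- x.2) (c.+1 - e) = l.
Proof.
elim: n l x => [|n IH] [|l] x; try by move=> // _; rewrite inE => /eqP ->; rewrite big_nil.
rewrite ltnS hexpS => ln /flattenP[s /mapP[m]]; rewrite mem_iota => mlt ->.
case/mapP=> y /IH yP -> /=.
rewrite big_cat big_cons /= yP; last by lia.
rewrite big_nseq iter_addn_0 subnn mul0n; lia.
Qed.

Section Content.

Variables k N : nat.

Definition label_count (B : {set 'I_k * 'I_N}) (i : 'I_N) : nat := \sum_(p in B) (p.2 == i).

Lemma tdinv_boxes_ext b b' (B : {set 'I_k * 'I_N}) :
  (forall x, x < k -> b x = b' x) -> tdinv_boxes b B = tdinv_boxes b' B.
Proof.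
move=> E; apply: eq_bigr => p _; apply: eq_bigr => p' _.
by rewrite /box_pos !E.
Qed.

End Content.

Section Join.

Variables (k N l : nat) (Bs : {set 'I_k * 'I_N}) (M : {ffun 'I_l -> {set 'I_k}}).
Local Notation B := (join_boxes Bs M).

Lemma label_count_small i : label_count B (lshift l i) = label_count Bs i.
Proof.
rewrite /label_count big_join /= [X in _ + X]big1 ?addn0 => [|x _].
  by apply: eq_bigr => p _; rewrite eq_lshift.
by rewrite big1 // => m _; rewrite eq_rlshift.
Qed.

Lemma label_count_big m : label_count B (rshift N m) + #|M m| = k.
Proof.
rewrite /label_count big_join /= big1 ?add0n => [|p _]; last by rewrite eq_lrshift.
rewrite -sum1_card [X in _ + X]big_mkcond -big_split /= -[RHS]card_ord -sum1_card.
apply: eq_bigr => x _; rewrite big_mkcond (bigD1 m) //= big1 ?addn0 => [|m' mm].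
  by rewrite eqxx; case: (_ \in _).
by rewrite eq_rshift (negbTE mm); case: ifP.
Qed.

Lemma sum_column_sum : \sum_x column_sum M x = \sum_m #|M m|.
Proof.
under eq_bigr do rewrite ffunE.
rewrite exchange_big; apply: eq_bigr => m _.
by rewrite -sum1_card [RHS]big_mkcond; apply: eq_bigr => x _; case: (_ \in _).
Qed.

End Join.

Lemma big_join_boxes (V : nmodType) k N l (P : pred {set 'I_k * 'I_(N + l)})
    (G : {set 'I_k * 'I_(N + l)} -> V) :
  (\sum_(B | P B) G B =
   \sum_(Bs : {set 'I_k * 'I_N}) \sum_(M : {ffun 'I_l -> {set 'I_k}} | P (join_boxes Bs M))
     G (join_boxes Bs M))%R.
Proof.
rewrite pair_big_dep /=.
rewrite (reindex (fun p : {set 'I_k * 'I_N} * {ffun 'I_l -> {set 'I_k}} => join_boxes p.1 p.2)) //=.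
pose small (B : {set 'I_k * 'I_(N + l)}) := [set p : 'I_k * 'I_N | (p.1, lshift l p.2) \in B].
pose missed (B : {set 'I_k * 'I_(N + l)}) :=
  [ffun m : 'I_l => [set x : 'I_k | (x, rshift N m) \notin B]].
exists (fun B => (small B, missed B)) => [[Bs M] _ /=|B _ /=].
  congr (_, _); first by apply/setP=> -[x a]; rewrite inE in_join_small.
  by apply/ffunP=> m; rewrite ffunE; apply/setP=> x; rewrite inE in_join_big negbK.
apply/setP=> -[x c]; case: (split_ordP c) => [a ->|m ->].
  by rewrite in_join_small inE.
by rewrite in_join_big ffunE inE negbK.
Qed.

Section Stack.

Variables (k N l : nat) (S : {ffun 'I_(k + l) -> 'I_k}).
Hypothesis S_stack : is_stack S.

Definition stack_excess : {ffun 'I_k -> nat} := [ffun x => (stack_width S x).-1].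

Lemma stack_excessE x : stack_width S x = (stack_excess x).+1.
Proof. by rewrite ffunE prednK // stack_width_gt0. Qed.

Lemma sum_stack_width : \sum_x stack_width S x = k + l.
Proof.
transitivity (width_sum S k); first by rewrite width_sumE //; apply: eq_bigl => x; rewrite ltn_ord.
by rewrite /width_sum -[RHS]card_ord; apply: eq_card => y; rewrite !inE ltn_ord.
Qed.

Lemma sum_stack_excess : \sum_x stack_excess x = l.
Proof.
apply: (@addnI k); rewrite -[RHS]sum_stack_width -[X in X + _]card_ord -sum1_card -big_split /=.
by apply: eq_bigr => x _; rewrite stack_excessE.
Qed.

Lemma width_sum_excess j : j <= k -> width_sum S j = j + \sum_(x < k | x < j) stack_excess x.
Proof.
move=> jk; rewrite width_sumE //; under eq_bigr do rewrite stack_excessE -add1n.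
rewrite big_split /=; congr (_ + _).
rewrite sum1_card -[RHS](@card_ord_lt k) //; apply: eq_card => x; by rewrite !inE.
Qed.

Variables (Bs : {set 'I_k * 'I_N}) (M : {ffun 'I_l -> {set 'I_k}}).
Hypothesis Md : column_sum M = stack_excess.
Local Notation B := (join_boxes Bs M).

(** A column gains [l - d x] extra letters while the line rises by [l + 1]; the net loss [d x + 1]
    is the width of the stack there. Hence the two families share their diagonals. *)
Lemma height_join_stack j : j <= k -> height B j + width_sum S j = height Bs j + l.+1 * j.
Proof. by move=> jk; have := height_join Bs M jk; rewrite Md width_sum_excess // mulSn; lia. Qed.

Lemma base_join j : j <= k -> diag_base l.+1 B j = stack_base S Bs j.
Proof. by move=> jk; have := height_join_stack jk; rewrite /diag_base /stack_base; lia. Qed.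

Lemma dyck_join : dyck_boxes l.+1 B = above_stack S Bs.
Proof.
apply: eq_forallb => j; have jk : j <= k by rewrite -ltnS.
by have := height_join_stack jk; lia.
Qed.

Lemma card_join_stack : (#|B| == k * l.+1) = (#|Bs| == k + l).
Proof. by have := card_join Bs M; rewrite Md sum_stack_excess mulnS mulnC; lia. Qed.

End Stack.

Section SignedCount.

Variables (F : fieldType) (q t : F).
Hypothesis q_neq0 : (q != 0)%R.
Variables (k l N : nat) (a : 'I_N -> nat).
Hypothesis k_gt0 : 0 < k.

Definition wpf_weight r m (B : {set 'I_k * 'I_m}) : F :=
  (t ^+ area_boxes r B *
     q ^ ((pathdinv_boxes r B)%:Z + (tdinv_boxes (diag_base r B) B)%:Z
          - (attacks (diag_base r B) B)%:Z))%R.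

Definition wld_weight n (S : {ffun 'I_n -> 'I_k}) (B : {set 'I_k * 'I_N}) : F :=
  (t ^+ (\sum_(x < k) stack_base S B x.+1)%N * q ^+ tdinv_boxes (stack_base S B) B)%R.

Definition wpf_coeff (es : seq nat) : F :=
  (\sum_(B : {set 'I_k * 'I_(N + l)} |
     [&& #|B| == k * l.+1, dyck_boxes l.+1 B,
         [forall i, label_count B (lshift l i) == a i]
       & [forall m, label_count B (rshift N m) == nth 0 es m]])
    wpf_weight l.+1 B)%R.

Definition wld_coeff : F :=
  (\sum_(S : {ffun 'I_(k + l) -> 'I_k} | is_stack S)
   \sum_(B : {set 'I_k * 'I_N} | [&& #|B| == k + l, above_stack S B &
       [forall i, label_count B i == a i]]) wld_weight S B)%R.

(** [box_statistics] solved for the exponent of q; the matrix cost enters with a minus sign, so the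
    signed sum is needed at 1/q. *)
Lemma wpf_weight_join (S : {ffun 'I_(k + l) -> 'I_k}) Bs (M : {ffun 'I_l -> {set 'I_k}}) :
  let ka := gstart k (fun x => stack_base S Bs x + col_size Bs x) in
  is_stack S -> column_sum M = stack_excess S -> above_stack S Bs -> #|Bs| = k + l ->
  (wpf_weight l.+1 (join_boxes Bs M) =
   wld_weight S Bs * q ^+ sorted_cost ka (stack_excess S) * q^-1 ^+ matrix_cost ka M)%R.
Proof.
move=> ka S_stack Md above Bsn.
have bE := base_join S_stack Bs Md.
have dyck : dyck_boxes l.+1 (join_boxes Bs M) by rewrite (dyck_join S_stack).
have card : #|join_boxes Bs M| = k * l.+1.
  by apply/eqP; rewrite (card_join_stack S_stack) // Bsn.
have kaE : gstart k (big_start Bs M) = ka.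
  by apply/ffunP=> x; rewrite !ffunE /big_start bE // ltnW.
have := box_statistics dyck card; rewrite kaE Md => stat.
rewrite /wpf_weight /wld_weight -!mulrA; congr (_ * _)%R.
  by congr (_ ^+ _)%R; apply: eq_bigr => x _; rewrite bE.
rewrite -(@tdinv_boxes_ext _ _ (diag_base l.+1 (join_boxes Bs M))); last by move=> x /ltnW/bE.
rewrite exprVn exprnN !exprnP -!expfzDr //.
congr (_ ^ _)%R; lia.
Qed.

Lemma signed_wpf_coeff :
  (\sum_(x <- hexp k.-1 l l) (-1) ^+ x.1 * wpf_coeff x.2 = wld_coeff)%R.
Proof.
pose content (Bs : {set 'I_k * 'I_N}) := [forall i, label_count Bs i == a i].
pose ka (S : {ffun 'I_(k + l) -> 'I_k}) (Bs : {set 'I_k * 'I_N}) :=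
  gstart k (fun x => stack_base S Bs x + col_size Bs x).
pose sizes (es : seq nat) (M : {ffun 'I_l -> {set 'I_k}}) :=
  [forall m : 'I_l, (#|M m| + nth 0 es m == k)].
pose ok (S : {ffun 'I_(k + l) -> 'I_k}) (Bs : {set 'I_k * 'I_N}) :=
  [&& #|Bs| == k + l, above_stack S Bs & content Bs].
have coeffE x : x \in hexp k.-1 l l -> wpf_coeff x.2 =
  (\sum_(S : {ffun 'I_(k + l) -> 'I_k} | is_stack S)
   \sum_(Bs : {set 'I_k * 'I_N} | ok S Bs)
     wld_weight S Bs * q ^+ sorted_cost (ka S Bs) (stack_excess S)
     * gsum (q^-1) x.2 (ka S Bs) (stack_excess S))%R.
  move=> xh; rewrite /wpf_coeff big_join_boxes.
  (* The column sums of a matrix determine its stack. Summing over all stacks a term that is nonzero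
     for at most one of them makes the stack an outer index. *)
  pose cond S Bs M := is_stack S && (ok S Bs && (sizes x.2 M && (column_sum M == stack_excess S))).
  pose term S Bs M := (if cond S Bs M then wpf_weight l.+1 (join_boxes Bs M) else 0)%R.
  transitivity (\sum_(Bs : {set 'I_k * 'I_N}) \sum_(M : {ffun 'I_l -> {set 'I_k}})
      \sum_(S : {ffun 'I_(k + l) -> 'I_k}) term S Bs M)%R.
    apply: eq_bigr => Bs _; rewrite big_mkcond; apply: eq_bigr => M _ /=.
    have -> : [forall i, label_count (join_boxes Bs M) (lshift l i) == a i] = content Bs.
      by apply: eq_forallb => i; rewrite label_count_small.
    have -> : [forall m, label_count (join_boxes Bs M) (rshift N m) == nth 0 x.2 m] = sizes x.2 M.
      by apply: eq_forallb => m; have := label_count_big Bs M m; lia.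
    case: (boolP (sizes x.2 M)) => sz; last first.
      by rewrite !andbF big1 // => S _; rewrite /term /cond (negbTE sz) !andbF.
    have sum_d : \sum_x column_sum M x = l.
      rewrite sum_column_sum -[RHS](hexp_sum (leqnn l) xh) prednK //.
      rewrite (big_nth 0) (size_hexp (leqnn l) xh) big_mkord; apply: eq_bigr => m _.
      by have := forallP sz m; lia.
    have [S0 S0_stack S0_width] :
        exists2 S : {ffun 'I_(k + l) -> 'I_k}, is_stack S &
          forall x, stack_width S x = (column_sum M x).+1.
      apply: stack_exists => //; apply: etrans (congr1 (addn k) sum_d).
      rewrite -[X in _ = X + _]card_ord -sum1_card -big_split.
      by apply: eq_bigr => y _.
    have S0_excess : column_sum M = stack_excess S0.
      by apply/ffunP=> y; rewrite [RHS]ffunE S0_width.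
    rewrite (bigD1 S0) //= [X in (_ + X)%R]big1 ?addr0 => [|S SS0].
      rewrite /term /cond S0_stack sz -S0_excess eqxx /= !andbT.
      by rewrite /ok (card_join_stack S0_stack Bs S0_excess) (dyck_join S0_stack Bs S0_excess).
    rewrite /term; case: ifP => // /and4P[S_stack _ _ /eqP S_excess]; case/eqP: SS0.
    apply: stack_inj => // y; rewrite (stack_excessE S_stack) (stack_excessE S0_stack).
    by rewrite -S_excess -S0_excess.
  under eq_bigr do rewrite exchange_big /=.
  rewrite exchange_big [RHS]big_mkcond /=; apply: eq_bigr => S _.
  case: (boolP (is_stack S)) => S_stack; last first.
    by rewrite big1 // => Bs _; rewrite big1 // => M _; rewrite /term /cond (negbTE S_stack).
  rewrite [RHS]big_mkcond; apply: eq_bigr => Bs _; case: (boolP (ok S Bs)) => okS; last first.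
    by rewrite big1 // => M _; rewrite /term /cond (negbTE okS) andbF.
  rewrite (gsum_matrix _ _ _ (size_hexp (leqnn l) xh)) big_distrr [RHS]big_mkcond /=.
  apply: eq_bigr => M _; rewrite /term /cond S_stack okS -/(sizes x.2 M) /=.
  case: ifP => // /andP[_ /eqP Md]; case/and3P: okS => /eqP Bsn above _.
  exact: wpf_weight_join.
rewrite /wld_coeff big_seq.
under eq_bigr => x xh do rewrite (coeffE x xh) big_distrr /=.
rewrite -big_seq exchange_big /=; apply: eq_bigr => S S_stack.
under eq_bigr do rewrite big_distrr /=.
rewrite exchange_big /=; apply: eq_bigr => Bs _.
under eq_bigr do rewrite mulrCA.
(* The signed sum at 1/q is the power of 1/q with exponent [sorted_cost], which cancels the power of
   q left by [wpf_weight_join]. *)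
rewrite -big_distrr /= gsum_hexp // sum_stack_excess // eqxx.
by rewrite exprVn mulfK // expf_neq0.
Qed.

End SignedCount.

(** * From signed counts of coefficients to the series *)

Local Open Scope ring_scope.

Section Functional.

Variables (S : comNzRingType) (F : nzRingType) (phi : S -> F).
Hypothesis phiD : forall f g, phi (f + g) = phi f + phi g.

Lemma additive0 : phi 0 = 0.
Proof. by apply: (addrI (phi 0)); rewrite -phiD !addr0. Qed.

Lemma additive_sign n f : phi ((-1) ^+ n * f) = (-1) ^+ n * phi f.
Proof.
have phiN g : phi (- g) = - phi g.
  by apply: (addrI (phi g)); rewrite -phiD !subrr additive0.
by rewrite -signr_odd -[in RHS]signr_odd; case: odd; rewrite !(expr0, expr1, mul1r, mulN1r).
Qed.

Variables (h : nat -> S) (c l : nat).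
Hypothesis phi_big : forall e : 'I_l -> nat, (exists i, (c.+1 < e i)%N) -> phi (\prod_i h (e i)) = 0.

(** h_j itself is nonzero for large j; only [phi] of a product containing it vanishes, and [phi] is
    merely additive. So h is truncated inside the Leibniz expansion, term by term, before the
    Hessenberg expansion applies. *)
Lemma additive_jtdet :
  phi (jtdet c h l) = \sum_(x <- hexp c l l) (-1) ^+ x.1 * phi (\prod_(e <- x.2) h e).
Proof.
pose h' j := if (j <= c.+1)%N then h j else 0.
have phi_sum (I : Type) (r : seq I) (P : pred I) (G : I -> S) :
    phi (\sum_(i <- r | P i) G i) = \sum_(i <- r | P i) phi (G i).
  exact: (big_morph phi phiD additive0).
transitivity (phi (jtdet c h' l)).
  have entries (s : 'I_l -> 'I_l) :
      phi (\prod_(i < l) jtentry c h i (s i)) = phi (\prod_(i < l) jtentry c h' i (s i)).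
    rewrite /jtentry.
    case: (boolP [forall i : 'I_l, (i <= c + s i)%N]) => [/forallP H|]; last first.
      rewrite negb_forall => /existsP[i Hi].
      by congr phi; rewrite (bigD1 i) // [RHS](bigD1 i) //= (negbTE Hi) !mul0r.
    have E (f : nat -> S) : \prod_(i < l) (if (i <= c + s i)%N then f (c + s i - i)%N else 0) =
        \prod_(i < l) f (c + s i - i)%N by apply: eq_bigr => i _; rewrite H.
    rewrite !E; case: (boolP [forall i : 'I_l, (c + s i - i <= c.+1)%N]) => [/forallP H'|].
      by congr phi; apply: eq_bigr => i _; rewrite /h' H'.
    rewrite negb_forall => /existsP[i Hi].
    rewrite (phi_big (e := fun i => c + s i - i)%N); last by exists i; rewrite ltnNge.
    by rewrite (bigD1 i) //= /h' (negbTE Hi) mul0r additive0.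
  rewrite /jtdet /determinant !phi_sum; apply: eq_bigr => s _; rewrite !additive_sign.
  congr (_ * _); under eq_bigr do rewrite mxE; under [in RHS]eq_bigr do rewrite mxE.
  exact: entries.
rewrite (@jtdet_hexp _ _ _ l) // => [|j]; last by rewrite /h' ltnNge => /negbTE ->.
rewrite phi_sum big_seq [RHS]big_seq; apply: eq_bigr => x xh.
rewrite additive_sign; congr (_ * phi _); apply: eq_big_seq => e ex.
by rewrite /h' (hexp_le xh ex).
Qed.

End Functional.

Lemma schur_rectangle l c : schur (nseq l c) = jtdet c hsf l.
Proof.
pose G m : Sym := \det (\matrix_(i < m, j < m)
    (if (i <= nth 0 (nseq l c) i + j)%N then hsf (nth 0 (nseq l c) i + j - i)%N else 0)).
have -> : schur (nseq l c) = G l.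
  by transitivity (G (size (nseq l c))); rewrite // size_nseq.
congr (\det _); apply/matrixP=> i j; rewrite !mxE.
by rewrite nth_nseq ltn_ord.
Qed.

Lemma hallDr f g1 g2 : hall f (g1 + g2) = hall f g1 + hall f g2.
Proof.
rewrite /hall -big_split; apply: eq_bigr => m _.
have -> : pcoeff (g1 + g2) m = pcoeff g1 m + pcoeff g2 m by exact: monalg.mcoeffD.
by rewrite (mulrDr (pcoeff f m)) (mulrDl _ _ (hall_z m)%:R).
Qed.

Lemma q_neq0 : q != 0.
Proof.
rewrite /q tofrac_eq0; apply/eqP => /(congr1 (mpoly.mcoeff U_(ord0)%MM)).
by rewrite mcoeffXU eqxx mpoly.mcoeff0 => /eqP; rewrite oner_eq0.
Qed.

Lemma mcoeff_box_monomial k N (c : Qqt) (B : {set 'I_k * 'I_N}) (a : 'X_{1..N}) :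
  mpoly.mcoeff a (c *: box_monomial B) =
  if [forall i, label_count B i == a i] then c else 0.
Proof.
have -> : box_monomial B = 'X_[[multinom label_count B i | i < N]].
  transitivity ('X_[(\sum_(p in B) U_(p.2))%MM] : mpoly.mpoly N Qqt).
    by rewrite (big_morph (fun m => 'X_[m] : mpoly.mpoly N Qqt) (@mpolyXD N Qqt) (@mpolyX0 N Qqt)).
  congr 'X_[_]; apply/mnmP=> i.
  by rewrite mnm_sumE mnmE; apply: eq_bigr => p _; rewrite mnm1E.
rewrite mpoly.mcoeffZ mcoeffX.
have -> : ([multinom label_count B i | i < N] == a) = [forall i, label_count B i == a i].
  apply/eqP/forallP => [<- i|H]; first by rewrite mnmE.
  by apply/mnmP=> i; rewrite mnmE; apply/eqP.
by case: ifP; rewrite ?mulr1 ?mulr0.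
Qed.

Lemma label_count_le k N (B : {set 'I_k * 'I_N}) i : (label_count B i <= k)%N.
Proof.
rewrite /label_count big_boxes -[X in (_ <= X)%N]card_ord -sum1_card; apply: leq_sum => x _.
rewrite big_mkcond (bigD1 i) //= big1 ?addn0 => [|j ji].
  by case: ifP => // _; apply: leq_b1.
by rewrite (negbTE ji); case: ifP.
Qed.

Section Assembly.

Variables (k l N : nat) (k_gt0 : (0 < k)%N) (f : Sym) (a : 'X_{1..N}).
Hypothesis shuffle : is_series f (wpf_series k l.+1).

Definition pairing (g : Sym) : Qqt := hall f (g * \prod_(i < N) hsf (a i)).

Lemma pairingD g1 g2 : pairing (g1 + g2) = pairing g1 + pairing g2.
Proof. by rewrite /pairing (mulrDl g1 g2) hallDr. Qed.

(** With [l] further variables, the indices [es] become exponents of the last ones; the product of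
    the h does not depend on this order, and it makes the extra letters the largest labels. *)
Lemma pairing_prod es : size es = l ->
  pairing (\prod_(e <- es) hsf e) = @wpf_coeff Qqt q t k l N a es.
Proof.
move=> es_l.
pose a' := [multinom (match split i with inl j => a j | inr m => nth 0%N es m end) | i < N + l].
have -> : pairing (\prod_(e <- es) hsf e) = mpoly.mcoeff a' (expand (N + l) f).
  rewrite mcoeff_expand /pairing; congr (hall f _).
  rewrite big_split_ord /= (big_nth 0%N) es_l big_mkord.
  rewrite (mulrC (\prod_(i < l) hsf (nth 0%N es i))); congr (_ * _); apply: eq_bigr => i _.
    by rewrite mnmE (unsplitK (inl i)).
  by rewrite mnmE (unsplitK (inr i)).
rewrite shuffle wpf_series_boxes // raddf_sum /= /wpf_coeff.
rewrite big_mkcond [RHS]big_mkcond; apply: eq_bigr => B _.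
rewrite mcoeff_box_monomial.
have -> : [forall i, label_count B i == a' i] =
    [forall i, label_count B (lshift l i) == a i] &&
    [forall m, label_count B (rshift N m) == nth 0%N es m].
  apply/forallP/andP => [H|[/forallP H1 /forallP H2] i].
    split; apply/forallP=> i.
      by have := H (lshift l i); rewrite mnmE (unsplitK (inl i)).
    by have := H (rshift N i); rewrite mnmE (unsplitK (inr i)).
  by rewrite mnmE; case: split_ordP => [j ->|m ->].
by rewrite [in RHS]andbA; case: (_ && dyck_boxes _ _).
Qed.

Lemma pairing_big (e : 'I_l -> nat) : (exists i, (k < e i)%N) ->
  pairing (\prod_(i < l) hsf (e i)) = 0.
Proof.
case=> i ei.
have -> : \prod_(i < l) hsf (e i) = \prod_(j <- [seq e i | i <- enum 'I_l]) hsf j.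
  by rewrite big_map big_enum.
rewrite pairing_prod; last by rewrite size_map size_enum_ord.
rewrite /wpf_coeff big1 // => B /and4P[_ _ _ /forallP/(_ i)].
rewrite (nth_map i) ?size_enum_ord // nth_ord_enum => /eqP E.
by have := label_count_le B (rshift N i); rewrite E leqNgt ei.
Qed.

End Assembly.

Theorem corollary1p4 (n k : nat) (k_gt0 : (0 < k)%N) (k_le_n : (k <= n)%N)
  (H : seq nat -> Sym) (H_macdonald : is_modified_macdonald H)
  (Delta' : {linear Sym -> Sym}) (Delta'_diag : is_Delta'_e H (k - 1) Delta')
  (Phi : Sym -> {linear Sym -> Sym}) (Phi_hom : is_Phi (n - k + 1) Phi)
  (skew : Sym -> Sym)
  (skew_adjoint :
     hall_adjoint skew (fun g => (schur (nseq (n - k)%N (k - 1)%N) * g)%R))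
  (rational_shuffle :
     is_series (Eop k (n - k + 1) Phi 1%R) (wpf_series k (n - k + 1)))
  (skewing : skew (Eop k (n - k + 1) Phi 1%R) = Delta' (esf n)) :
  is_series (Delta' (esf n)) (wld_series n k).
Proof.
move=> N; rewrite -skewing; move: rational_shuffle; rewrite addn1.
move: (Eop _ _ _ _) => f shuffle; apply/mpolyP => a.
rewrite mcoeff_expand skew_adjoint schur_rectangle subn1.
(* With [k + l] for [n] the slope is [l + 1], the form in which the box counts are stated. *)
move: (n - k)%N (subnKC k_le_n) shuffle => l <- shuffle.
rewrite -/(pairing f a (jtdet k.-1 hsf l)).
rewrite (additive_jtdet (pairingD f a)); last first.
  by move=> e; rewrite prednK //; apply: pairing_big.
rewrite big_seq; under eq_bigr => x xh do
  rewrite (pairing_prod k_gt0 _ shuffle (size_hexp (leqnn l) xh)).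
rewrite -big_seq (signed_wpf_coeff _ q_neq0) //.
rewrite wld_series_boxes raddf_sum /wld_coeff; apply: eq_bigr => S _.
rewrite raddf_sum /= big_mkcond [RHS]big_mkcond; apply: eq_bigr => B _.
rewrite mcoeff_box_monomial.
by rewrite [in LHS]andbA; case: (_ && above_stack _ _).
Qed.
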